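(* Consider a Clifford VQA on $n$ qubits with observable $O=\sum_{j=1}^N c_jP_j$, $|c_j|\le c_{\max}$, $m$ parameters, loss $L=\sum_jL_j$ with $L_j=c_j\ell_j$ and $\ell_j(\boldsymbol\phi)=\operatorname{Tr}[\rho\,U^\dagger(\boldsymbol\phi)P_jU(\boldsymbol\phi)]$. Fix an index $i$ and a partition $\{1,\dots,m\}=S\sqcup F$ of the parameter indices; write $\boldsymbol\phi=(\boldsymbol\theta,\boldsymbol\varphi)$ with $\boldsymbol\theta\in[0,2\pi)^S$ (fixed angles) and $\boldsymbol\varphi\in[0,2\pi)^F$ (null directions). Let $\boldsymbol\theta_i\in\{0,\pi/2,\pi,3\pi/2\}^S$ and assume: 1. $L_i(\boldsymbol\theta_i,\boldsymbol\varphi)=-|c_i|$ for all $\boldsymbol\varphi\in[0,2\pi)^F$; 2. there are constants $C>0$, $b>1$ such that for every $j\neq i$, $\mathbb{E}_{\boldsymbol\varphi}\big[\ell_j(\boldsymbol\theta_i,\boldsymbol\varphi)^2\big]\le C\,b^{-n}$; 3. the same bound $\mathbb{E}_{\boldsymbol\varphi}\big[\ell_j(\boldsymbol\theta',\boldsymbol\varphi)^2\big]\le C\,b^{-n}$ holds for every $j\neq i$ and every $\boldsymbol\theta'$ obtained from $\boldsymbol\theta_i$ by adding multiples of $\pi/2$ to at most two of its components. Then: (i) For $0<\epsilon\le1$ and $\boldsymbol\varphi$ sampled uniformly from $[0,2\pi)^F$, the point $(\boldsymbol\theta_i,\boldsymbol\varphi)$ is an $\epsilon$-approximate local minimum of $L$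 with probability at least $1-\mathcal{O}\big(\mathrm{poly}(N,m,c_{\max})\,C\,\epsilon^{-2}b^{-n}\big)$. (ii) For $\boldsymbol\varphi_c$ sampled uniformly from $\{0,\pi/2,\pi,3\pi/2\}^F$, the point $(\boldsymbol\theta_i,\boldsymbol\varphi_c)$ is a $0$-approximate local minimum of $L$ with probability at least $1-\mathcal{O}\big(\mathrm{poly}(N,m)\,C\,b^{-n}\big)$.
   Context: A Clifford VQA on $n$ qubits consists of: a stabilizer initial state $\rho$; an observable $O=\sum_{j=1}^N c_jP_j$ with real $c_j$ and Pauli strings $P_j$; and a circuit $U(\boldsymbol\phi)$, $\boldsymbol\phi\in[0,2\pi)^m$, which is a product of fixed Clifford gates and Pauli rotations $e^{-iQ_k\phi_k/2}$ ($Q_k$ Pauli strings), each parameter appearing in exactly one rotation. $\mathbb{E}_{\boldsymbol\varphi}$ denotes the average over $\boldsymbol\varphi$ uniform on $[0,2\pi)^F$. For $\epsilon\ge0$, a point $\boldsymbol\phi_*$ is an $\epsilon$-approximate local minimum of $L$ if $|\partial_{\phi_k}L(\boldsymbol\phi_* )|\le\epsilon$ for all $k$ and the smallest eigenvalue of the Hessian $\nabla^2L(\boldsymbol\phi_* )$ is at least $-\sqrt{\epsilon}$; thus a $0$-approximate local minimum is a point with vanishing gradient and positive semidefinite Hessian. *)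

(* Defs.v *)
From HB Require Import structures.
From mathcomp Require Import all_boot all_order all_algebra.
From mathcomp Require Import all_classical all_reals all_analysis.
From mathcomp.real_closed Require Import complex.
From Stdlib Require List.
Set Implicit Arguments.
Unset Strict Implicit.
Unset Printing Implicit Defensive.
Import Order.TTheory GRing.Theory Num.Theory.
Local Open Scope ring_scope.

(* ---------- Pauli strings on n qubits ---------- *)

(* k-th bit of a computational-basis index x of the 2^n-dimensional space *)
Definition bit (x k : nat) : bool := odd (x %/ 2 ^ k).

(* single-qubit Pauli matrices: 0 = I, 1 = X, 2 = Y, 3 = Z; entry (u, v) *)
Definition sigma (R : realType) (a : 'I_4) (u v : bool) : R[i] :=
  match val a with
  | 0 => if u == v then 1 else 0
  | 1 => if u == v then 0 else 1
  | 2 => if u == v then 0 else (if u then 'i%C else - 'i%C)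
  | _ => if u == v then (if u then -1 else 1) else 0
  end.

(* a Pauli string: one single-qubit Pauli per qubit *)
Definition pauli (n : nat) := {ffun 'I_n -> 'I_4}.

(* its matrix: the tensor product of the single-qubit Paulis *)
Definition pauli_mx (R : realType) (n : nat) (P : pauli n) : 'M[R[i]]_(2 ^ n) :=
  \matrix_(x, y) \prod_(k < n) sigma R (P k) (bit x k) (bit y k).

(* conjugate transpose *)
Definition adj (R : realType) (p q : nat) (M : 'M[R[i]]_(p, q)) : 'M[R[i]]_(q, p) :=
  (map_mx (fun z => (z^*)%C) M)^T.

Definition unitary (R : realType) (n : nat) (U : 'M[R[i]]_(2 ^ n)) : Prop :=
  U *m adj U = 1%:M.

(* Clifford unitary: normalizes the Pauli group (up to phases) *)
Definition clifford (R : realType) (n : nat) (U : 'M[R[i]]_(2 ^ n)) : Prop :=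
  unitary U /\
  forall P : pauli n, exists (P' : pauli n) (s : R[i]),
    (s = 1 \/ s = -1 \/ s = 'i%C \/ s = - 'i%C) /\
    U *m pauli_mx R P *m adj U = s *: pauli_mx R P'.

(* |0...0><0...0| *)
Definition ket0bra0 (R : realType) (n : nat) : 'M[R[i]]_(2 ^ n) :=
  \matrix_(x, y) (if (x == 0%N :> nat) && (y == 0%N :> nat) then 1 else 0).

(* stabilizer state: rho = V |0><0| V^dagger for a Clifford V *)
Definition stabilizer_state (R : realType) (n : nat) (rho : 'M[R[i]]_(2 ^ n)) : Prop :=
  exists V : 'M[R[i]]_(2 ^ n), clifford V /\ rho = V *m ket0bra0 R n *m adj V.

(* ---------- Parameterized Clifford circuits ---------- *)

(* a gate is either a fixed (Clifford) gate or a Pauli rotation exp(-i Q phi_k / 2) *)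
Inductive gate (R : realType) (n m : nat) :=
  | GFix of 'M[R[i]]_(2 ^ n)
  | GRot of pauli n & 'I_m.

(* exp(-i Q t / 2) = cos(t/2) I - i sin(t/2) Q   (since Q^2 = I) *)
Definition rot_mx (R : realType) (n : nat) (Q : pauli n) (t : R) : 'M[R[i]]_(2 ^ n) :=
  (cos (t / 2))%:C%C *: 1%:M - ('i%C * (sin (t / 2))%:C%C) *: pauli_mx R Q.

Definition gate_mx (R : realType) (n m : nat) (g : gate R n m) (phi : 'rV[R]_m)
  : 'M[R[i]]_(2 ^ n) :=
  match g with
  | GFix M => M
  | GRot Q k => rot_mx Q (phi 0 k)
  end.

Definition is_rot_on (R : realType) (n m : nat) (k : 'I_m) (g : gate R n m) : bool :=
  match g with GFix _ => false | GRot _ k' => k' == k end.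

(* gates listed in order of application: U = G_L ... G_2 G_1 *)
Definition circ_mx (R : realType) (n m : nat) (gs : seq (gate R n m)) (phi : 'rV[R]_m)
  : 'M[R[i]]_(2 ^ n) :=
  foldl (fun acc g => gate_mx g phi *m acc) 1%:M gs.

(* fixed gates are Clifford; each parameter appears in exactly one rotation *)
Definition clifford_circuit (R : realType) (n m : nat) (gs : seq (gate R n m)) : Prop :=
  (forall g, List.In g gs ->
     match g with GFix M => clifford M | GRot _ _ => True end) /\
  (forall k : 'I_m, count (is_rot_on k) gs = 1%N).

(* ell_P(phi) = Tr[rho U^dagger(phi) P U(phi)]  (real; we take the real part) *)
Definition ell (R : realType) (n m : nat) (rho : 'M[R[i]]_(2 ^ n)) (gs : seq (gate R n m))
  (P : pauli n) (phi : 'rV[R]_m) : R :=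
  complex.Re (\tr (rho *m adj (circ_mx gs phi) *m pauli_mx R P *m circ_mx gs phi)).

(* L(phi) = sum_j c_j ell_{P_j}(phi) *)
Definition loss (R : realType) (n m N : nat) (rho : 'M[R[i]]_(2 ^ n)) (gs : seq (gate R n m))
  (c : 'I_N -> R) (P : 'I_N -> pauli n) (phi : 'rV[R]_m) : R :=
  \sum_(j < N) c j * ell rho gs (P j) phi.

(* ---------- Calculus ---------- *)

Definition unitv (R : realType) (m : nat) (k : 'I_m) : 'rV[R]_m := delta_mx 0 k.

(* partial derivative with respect to phi_k *)
Definition partial (R : realType) (m : nat) (k : 'I_m) (f : 'rV[R]_m -> R) (x : 'rV[R]_m) : R :=
  derive1 (fun t : R => f (x + t *: unitv R k)) 0.

Definition hessian (R : realType) (m : nat) (f : 'rV[R]_m -> R) (x : 'rV[R]_m) : 'M[R]_m :=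
  \matrix_(k, l) partial l (partial k f) x.

(* eps-approximate local minimum: |grad| <= eps componentwise, and the smallest
   eigenvalue of the Hessian is >= -sqrt eps (i.e. every eigenvalue is) *)
Definition approx_local_min (R : realType) (m : nat) (eps : R) (f : 'rV[R]_m -> R)
  (x : 'rV[R]_m) : Prop :=
  (forall k : 'I_m, `|partial k f x| <= eps) /\
  (forall a : R, eigenvalue (hessian f x) a -> - Num.sqrt eps <= a).

(* ---------- Parameter splitting and averages ---------- *)

(* x with coordinate k replaced by t *)
Definition upd (R : realType) (m : nat) (x : 'rV[R]_m) (k : 'I_m) (t : R) : 'rV[R]_m :=
  \row_l (if l == k then t else x 0 l).

(* iterated average of f over the coordinates listed in s, each coordinate averaged
   with the one-dimensional averaging functional A; other coordinates taken from x *)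
Fixpoint iter_avg (R : realType) (m : nat) (A : (R -> R) -> R) (s : seq 'I_m)
  (f : 'rV[R]_m -> R) (x : 'rV[R]_m) : R :=
  match s with
  | [::] => f x
  | k :: s' => A (fun t => iter_avg A s' f (upd x k t))
  end.

(* uniform average on [0, 2 pi) *)
Definition unif_avg (R : realType) (g : R -> R) : R :=
  (pi *+ 2)^-1 * Rintegral (@lebesgue_measure R) `[0, pi *+ 2[%classic g.

(* uniform average on {0, pi/2, pi, 3 pi/2} *)
Definition cliff_avg (R : realType) (g : R -> R) : R :=
  4^-1 * \sum_(a < 4) g (a%:R * pi / 2).

(* expectation over phi uniform on [0,2pi)^F, F = complement of S; the S-coordinates
   are those of x *)
Definition E_unif (R : realType) (m : nat) (S : {set 'I_m}) (f : 'rV[R]_m -> R)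
  (x : 'rV[R]_m) : R :=
  iter_avg (@unif_avg R) (enum (~: S)) f x.

(* expectation over phi_c uniform on {0,pi/2,pi,3pi/2}^F *)
Definition E_cliff (R : realType) (m : nat) (S : {set 'I_m}) (f : 'rV[R]_m -> R)
  (x : 'rV[R]_m) : R :=
  iter_avg (@cliff_avg R) (enum (~: S)) f x.

(* probability of an event (a set of full parameter vectors) *)
Definition P_unif (R : realType) (m : nat) (S : {set 'I_m}) (E : set 'rV[R]_m)
  (x : 'rV[R]_m) : R := E_unif S (\1_E) x.

Definition P_cliff (R : realType) (m : nat) (S : {set 'I_m}) (E : set 'rV[R]_m)
  (x : 'rV[R]_m) : R := E_cliff S (\1_E) x.

(* the point (theta, phi): S-coordinates from theta, F-coordinates from phi *)
Definition join_pt (R : realType) (m : nat) (S : {set 'I_m}) (theta phi : 'rV[R]_m)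
  : 'rV[R]_m := \row_k (if k \in S then theta 0 k else phi 0 k).

(* Clifford angles a_k * pi/2 *)
Definition cliff_angles (R : realType) (m : nat) (a : 'I_m -> 'I_4) : 'rV[R]_m :=
  \row_k ((a k)%:R * pi / 2).

(* theta_i shifted by t_k * pi/2 on the coordinates k in S *)
Definition shifted_angles (R : realType) (m : nat) (S : {set 'I_m}) (a : 'I_m -> 'I_4)
  (t : 'I_m -> int) : 'rV[R]_m :=
  \row_k ((a k)%:R * pi / 2 + (if k \in S then (t k)%:~R * pi / 2 else 0)).

(* Main.v *)
(** In every coordinate the vector U(phi) V |0> is a combination of
    cos(phi_k / 2) and sin(phi_k / 2) ("half-angle").  Hence each ell_j is a
    first-degree trigonometric polynomial in each coordinate, partial derivatives are
    differences of quarter-turn shifts, and gradient and Hessian of L only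
    involve values of the ell_j at phi shifted by quarter turns in at most two
    coordinates.

    At a point where L_i = -|c_i|, the identity
    L_i + |c_i| = (|c_i| / 2) |(1 + s P_i) U V |0>|^2, with s the sign of c_i,
    writes L_i + |c_i| as a sum of squares of half-angle functions vanishing
    there, so that L_i has zero gradient and its Hessian is a Gram matrix.  It
    remains to see that the shifted ell_j, j <> i, are small.

    The four-point average over {0, pi/2, pi, 3pi/2} integrates trigonometric
    polynomials of degree two exactly, so the uniform and the Clifford averages
    of ell_j^2 agree, and the latter is invariant under quarter-turn shifts.
    Thus the sum Z of the ell_j^2 over all j <> i and all shifts has
    expectation at most 9 N m^2 C b^-n.  Part (i) bounds the indicator of the
    good event from below by 1 - Z / delta^2; for part (ii), ell_j is -1, 0 or 1
    at Clifford points, so delta is not needed: either Z = 0 or Z >= 1. *)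

Require Import Defs.
From HB Require Import structures.
From mathcomp Require Import all_boot all_order all_algebra.
From mathcomp Require Import all_classical all_reals all_analysis.
From mathcomp.real_closed Require Import complex.
From mathcomp Require Import measurable_realfun ring lra.
Set Implicit Arguments.
Unset Strict Implicit.
Unset Printing Implicit Defensive.
Import Order.TTheory GRing.Theory Num.Theory.
Import numFieldNormedType.Exports.
Local Open Scope ring_scope.

(** * Averages of trigonometric polynomials *)

Definition trig1 (R : realType) (g : R -> R) : Prop :=
  exists c0 c1 c2 : R, forall t, g t = c0 + c1 * cos t + c2 * sin t.

(** Trigonometric polynomials of degree at most two: [sin t ^+ 2] is covered, being
    [1 - cos t ^+ 2]. *)
Definition trig2 (R : realType) (g : R -> R) : Prop :=
  exists c0 c1 c2 c3 c4 : R, forall t,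
    g t = c0 + c1 * cos t + c2 * sin t + c3 * cos t ^+ 2 + c4 * (sin t * cos t).

Section Averages.
Variable R : realType.
Implicit Types (f g : R -> R) (t : R).

Lemma cos3pihalf : cos (3 * pi / 2) = 0 :> R.
Proof.
have -> : 3 * pi / 2 = pi / 2 + pi :> R by field.
by rewrite cosDpi cos_pihalf oppr0.
Qed.

Lemma sin3pihalf : sin (3 * pi / 2) = - 1 :> R.
Proof.
have -> : 3 * pi / 2 = pi / 2 + pi :> R by field.
by rewrite sinDpi sin_pihalf.
Qed.

Lemma cliff_avgE g :
  cliff_avg g = 4^-1 * (g 0 + g (pi / 2) + g pi + g (3 * pi / 2)).
Proof.
rewrite /cliff_avg !big_ord_recr big_ord0 /= add0r !mul0r mul1r.
by have -> : 2 * pi / 2 = pi :> R by field.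
Qed.

Lemma cliff_avg_trig2 (c0 c1 c2 c3 c4 : R) :
  cliff_avg (fun t => c0 + c1 * cos t + c2 * sin t + c3 * cos t ^+ 2
                      + c4 * (sin t * cos t)) = c0 + c3 / 2.
Proof.
rewrite cliff_avgE cos0 sin0 cos_pihalf sin_pihalf cospi sinpi cos3pihalf
  sin3pihalf; by field.
Qed.

Lemma integral_trig2 (c0 c1 c2 c3 c4 : R) :
  (\int[@lebesgue_measure R]_(t in `[0%R, (pi *+ 2)%R[)
     (c0 + c1 * cos t + c2 * sin t + c3 * cos t ^+ 2 + c4 * (sin t * cos t))%:E
   = ((pi *+ 2) * (c0 + c3 / 2))%:E)%E.
Proof.
pose g (t : R) := c0 + c1 * cos t + c2 * sin t + c3 * cos t ^+ 2
                   + c4 * (sin t * cos t).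
(* An antiderivative of [g]: [t + sin t * cos t] has derivative [2 * cos t ^+ 2]. *)
pose G (t : R) := c0 * t + c1 * sin t - c2 * cos t + c3 / 2 * (t + sin t * cos t)
                   + c4 / 2 * (sin t * sin t).
have dG (t : R) : is_derive t 1 G (g t).
  rewrite /G; apply: is_derive_eq.
  rewrite /g /GRing.scale /= -[X in _ = _ + _ * X + _](mulr1 (cos t ^+ 2)).
  have E : cos t ^+ 2 = (1 + cos t ^+ 2 - sin t ^+ 2) / 2.
    by have := cos2Dsin2 t; lra.
  by rewrite mulr1 [in RHS]E; field.
have cg : continuous g.
  move=> t; apply: differentiable_continuous; apply/derivable1_diffP.
  by rewrite /g; apply: ex_derive.
have cG : continuous G.
  move=> t; apply: differentiable_continuous; apply/derivable1_diffP.
  by apply: ex_derive.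
have p0 : (0 : R) < pi *+ 2 by rewrite pmulrn_lgt0 ?pi_gt0.
rewrite (@integral_itv_bndo_bndc R (BLeft 0) (pi *+ 2) (EFin \o g)); last first.
  apply/measurable_EFinP; apply: measurable_funTS.
  exact: continuous_measurable_fun.
rewrite (@continuous_FTC2 R g G 0 (pi *+ 2)) //.
- rewrite /G cos2pi sin2pi cos0 sin0 -EFinB; congr EFin.
  by rewrite !mulr0; field.
- exact: continuous_subspaceT.
- split; first by move=> t _; apply: ex_derive.
    exact: cvg_at_right_filter (cG 0).
  exact: cvg_at_left_filter (cG (pi *+ 2)).
- by move=> t _; rewrite derive1E; apply: derive_val.
Qed.

(** Both averages equal [c0 + c3 / 2]. *)
Lemma unif_avg_trig2 g : trig2 g -> unif_avg g = cliff_avg g.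
Proof.
move=> [c0 [c1 [c2 [c3 [c4 E]]]]].
have -> : g = fun t => c0 + c1 * cos t + c2 * sin t + c3 * cos t ^+ 2
                   + c4 * (sin t * cos t) by apply/funext.
rewrite cliff_avg_trig2 /unif_avg /Rintegral integral_trig2 /=.
by rewrite mulKf // mulrn_eq0 /= gt_eqF ?pi_gt0.
Qed.

(* The integral of a nonnegative function is a supremum over simple functions,
   so it is monotone without any measurability. *)
Lemma le_integral_nonmeas (D : set R) (f g : R -> \bar R) :
  (forall t, D t -> 0 <= f t)%E -> (forall t, D t -> f t <= g t)%E ->
  (\int[@lebesgue_measure R]_(t in D) f t
   <= \int[@lebesgue_measure R]_(t in D) g t)%E.
Proof.
move=> f0 fg.
rewrite !ge0_integralE //; last by move=> t Dt; exact: le_trans (f0 _ Dt) (fg _ Dt).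
apply: le_ereal_sup => _ [h hf <-]; exists h => // t.
exact: le_trans (hf t) (lee_restrict fg t).
Qed.

(** Keeps the integral finite, so that [Rintegral] does not return its default value at infinity. *)
Lemma integral_unit (f : R -> R) : (forall t, 0 <= f t <= 1) ->
  (0 <= \int[@lebesgue_measure R]_(t in `[0%R, (pi *+ 2)%R[) (f t)%:E
   <= (pi *+ 2)%:E)%E.
Proof.
move=> f01; apply/andP; split.
  by apply: integral_ge0 => t _; rewrite lee_fin; case/andP: (f01 t).
have -> : (pi *+ 2)%:E =
    (\int[@lebesgue_measure R]_(t in `[0%R, (pi *+ 2)%R[) (1 + 0 * cos t +
      0 * sin t + 0 * cos t ^+ 2 + 0 * (sin t * cos t))%:E)%E.
  by rewrite integral_trig2 mul0r addr0 mulr1.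
by apply: le_integral_nonmeas => t _; rewrite lee_fin ?mul0r ?addr0;
  case/andP: (f01 t).
Qed.

Lemma unif_avg_unit (f : R -> R) :
  (forall t, 0 <= f t <= 1) -> 0 <= unif_avg f <= 1.
Proof.
move=> f01; rewrite /unif_avg /Rintegral; have := integral_unit f01.
have p0 : (0 : R) < pi *+ 2 by rewrite pmulrn_lgt0 ?pi_gt0.
case: (integral _ _ _) => [r||]; rewrite ?leye_eq ?andbF // !lee_fin => /andP[r0 r1] /=.
by rewrite mulr_ge0 ?invr_ge0 ?(ltW p0) //= ler_pdivrMl // mulr1.
Qed.

(** Here [f] will be an average of the indicator of the event, whose measurability is not
    established; the polynomial minorant [g] carries the computation. *)
Lemma cliff_avg_le_unif_avg (f g : R -> R) : (forall t, 0 <= f t <= 1) ->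
  trig2 g -> (forall t, 0 <= t < pi *+ 2 -> g t <= f t) ->
  cliff_avg g <= unif_avg f.
Proof.
move=> f01 tg gf; rewrite -unif_avg_trig2 //.
have p0 : (0 : R) < pi *+ 2 by rewrite pmulrn_lgt0 ?pi_gt0.
rewrite /unif_avg ler_wpM2l ?invr_ge0 ?(ltW p0) // /Rintegral.
have gfI : (\int[@lebesgue_measure R]_(t in `[0%R, (pi *+ 2)%R[) (g t)%:E
    <= \int[@lebesgue_measure R]_(t in `[0%R, (pi *+ 2)%R[) (f t)%:E)%E.
  (* The integral of [g] is at most that of its positive part, which lies below [f] on the domain
     because [f] is nonnegative. *)
  rewrite [leLHS]integralE.
  apply: (@le_trans _ _ (\int[@lebesgue_measure R]_(t in `[0%R, (pi *+ 2)%R[)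
            ((EFin \o g)^\+ t))%E).
    by rewrite -[leRHS]sube0; apply: leeB => //; apply: integral_ge0.
  apply: le_integral_nonmeas => // t.
  rewrite /= in_itv /= => /gf gft.
  by rewrite funeposE /= ge_max !lee_fin gft; case/andP: (f01 t).
have := integral_unit f01; move: gfI.
case: tg => [c0 [c1 [c2 [c3 [c4 E]]]]].
under eq_integral do rewrite E.
rewrite integral_trig2.
by case: (integral _ _ _) => [r||] //=; rewrite ?leye_eq ?andbF // !lee_fin.
Qed.

Lemma cliff_avg_unit (f : R -> R) :
  (forall t, 0 <= f t <= 1) -> 0 <= cliff_avg f <= 1.
Proof.
move=> f01; rewrite cliff_avgE.
by have := f01 0; have := f01 (pi / 2); have := f01 pi; have := f01 (3 * pi / 2);
  lra.
Qed.

Lemma cliff_avg_le (f g : R -> R) :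
  (forall b : 'I_4, g (b%:R * pi / 2) <= f (b%:R * pi / 2)) ->
  cliff_avg g <= cliff_avg f.
Proof. by move=> gf; rewrite ler_wpM2l ?invr_ge0 // ler_sum. Qed.

End Averages.

(** * Iterated averages over several coordinates *)

Definition coord_trig1 (R : realType) (m : nat) (F : 'rV[R]_m -> R) : Prop :=
  forall k x, trig1 (fun t => F (upd x k t)).

Definition coord_trig2 (R : realType) (m : nat) (F : 'rV[R]_m -> R) : Prop :=
  forall k x, trig2 (fun t => F (upd x k t)).

Section IteratedAverages.
Variables (R : realType) (m : nat).
Implicit Types (F G : 'rV[R]_m -> R) (x y : 'rV[R]_m) (k l : 'I_m) (t u : R).

Lemma trig2_cst (c : R) : trig2 (fun=> c).
Proof. by exists c, 0, 0, 0, 0 => t; rewrite !mul0r !addr0. Qed.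

Lemma trig2D (f g : R -> R) : trig2 f -> trig2 g -> trig2 (fun t => f t + g t).
Proof.
move=> [a0 [a1 [a2 [a3 [a4 Ef]]]]] [b0 [b1 [b2 [b3 [b4 Eg]]]]].
exists (a0 + b0), (a1 + b1), (a2 + b2), (a3 + b3), (a4 + b4) => t.
by rewrite Ef Eg; ring.
Qed.

Lemma trig2Z (c : R) (f : R -> R) : trig2 f -> trig2 (fun t => c * f t).
Proof.
move=> [a0 [a1 [a2 [a3 [a4 Ef]]]]].
by exists (c * a0), (c * a1), (c * a2), (c * a3), (c * a4) => t; rewrite Ef; ring.
Qed.

Lemma trig2_sum (I : Type) (r : seq I) (p : pred I) (f : I -> R -> R) :
  (forall i, trig2 (f i)) -> trig2 (fun t => \sum_(i <- r | p i) f i t).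
Proof.
move=> tf; elim: r => [|i r IH].
  by under eq_fun do rewrite big_nil; exact: trig2_cst.
under eq_fun do rewrite big_cons.
by case: (p i) => //; exact: trig2D.
Qed.

Lemma trig1_sqr (f : R -> R) : trig1 f -> trig2 (fun t => f t ^+ 2).
Proof.
move=> [a0 [a1 [a2 Ef]]].
exists (a0 ^+ 2 + a2 ^+ 2), (2 * a0 * a1), (2 * a0 * a2), (a1 ^+ 2 - a2 ^+ 2),
  (2 * a1 * a2) => t.
by have := cos2Dsin2 t; rewrite Ef; nra.
Qed.

Lemma trig2_shift (f : R -> R) u : trig2 f -> trig2 (fun t => f (t + u)).
Proof.
move=> [a0 [a1 [a2 [a3 [a4 Ef]]]]].
set p := cos u; set q := sin u.
exists (a0 + a3 * q ^+ 2 - a4 * (p * q)), (a1 * p + a2 * q), (a2 * p - a1 * q),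
  (a3 * (p ^+ 2 - q ^+ 2) + 2 * a4 * p * q),
  (a4 * (p ^+ 2 - q ^+ 2) - 2 * a3 * p * q) => t.
have := cos2Dsin2 t; rewrite Ef sinD cosD -/p -/q => /(canRL (addKr _)) E.
have {}E : sin t * sin t = 1 - cos t ^+ 2 by rewrite -expr2 E; ring.
transitivity (a0 + a1 * (cos t * p - sin t * q) + a2 * (sin t * p + cos t * q)
 + a3 * (cos t ^+ 2 * p ^+ 2 - 2 * p * q * (sin t * cos t) + (sin t * sin t) * q ^+ 2)
 + a4 * (sin t * cos t * p ^+ 2 - sin t * sin t * (p * q) + cos t ^+ 2 * (p * q)
         - sin t * cos t * q ^+ 2)); first by ring.
by rewrite E; ring.
Qed.

Lemma upd_upd x k t u : upd (upd x k t) k u = upd x k u.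
Proof. by apply/rowP => l; rewrite !mxE; case: eqP. Qed.

Lemma updC x k l t u : k != l -> upd (upd x k t) l u = upd (upd x l u) k t.
Proof.
move=> kl; apply/rowP => j; rewrite !mxE; case: (eqVneq j l) => [->|//].
by rewrite eq_sym (negbTE kl).
Qed.

Lemma upd_add x y k t : upd x k t + y = upd (x + y) k (t + y 0 k).
Proof. by apply/rowP => l; rewrite !mxE; case: eqP => [->|]. Qed.

Lemma coord_trig2_upd F k u : coord_trig2 F -> coord_trig2 (fun x => F (upd x k u)).
Proof.
move=> tF l x; have [->|kl] := eqVneq l k.
  by under eq_fun do rewrite upd_upd; exact: trig2_cst.
by under eq_fun do rewrite updC //; exact: tF.
Qed.

Lemma coord_trig2_translate F y : coord_trig2 F -> coord_trig2 (fun x => F (x + y)).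
Proof.
move=> tF k x; under eq_fun do rewrite upd_add.
exact: (trig2_shift (y 0 k) (tF k (x + y))).
Qed.

Lemma iter_cliff_avg_trig2 s F :
  coord_trig2 F -> coord_trig2 (iter_avg (@cliff_avg R) s F).
Proof.
move=> tF; elim: s => [|k s IH] //= l x.
apply: trig2Z; apply: trig2_sum => b.
by have := @coord_trig2_upd _ k (b%:R * pi / 2) IH; apply.
Qed.

(** One coordinate at a time: the inner four-point average is again of degree two in each
    coordinate, so the one-dimensional equality applies to it. *)
Lemma iter_unif_avgE s F x : coord_trig2 F ->
  iter_avg (@unif_avg R) s F x = iter_avg (@cliff_avg R) s F x.
Proof.
move=> tF; elim: s x => [|k s IH] //= x.
under eq_fun do rewrite IH.
by apply: unif_avg_trig2; exact: iter_cliff_avg_trig2.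
Qed.

Lemma iter_cliff_avg_affine (I : Type) (r : seq I) (p : pred I)
    (F : I -> 'rV[R]_m -> R) (c w : R) s x :
  iter_avg (@cliff_avg R) s (fun y => c - w * \sum_(i <- r | p i) F i y) x
  = c - w * \sum_(i <- r | p i) iter_avg (@cliff_avg R) s (F i) x.
Proof.
elim: s x => [|k s IH] //= x.
under eq_fun do rewrite IH.
rewrite /cliff_avg big_split /= sumr_const card_ord sumrN -mulr_sumr exchange_big /=.
rewrite -mulr_sumr -(mulr_natr c); by field.
Qed.

Lemma eq_iter_avg A s F x y : (forall k, k \notin s -> x 0 k = y 0 k) ->
  iter_avg A s F x = iter_avg A s F y.
Proof.
elim: s x y => [|k s IH] /= x y xy.
  by congr F; apply/rowP => k; apply: xy.
congr A; apply/funext => t; apply: IH => l ls; rewrite !mxE.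
by case: eqVneq => // lk; apply: xy; rewrite inE (negbTE lk).
Qed.

(** A quarter turn permutes the four points modulo a full period, which trigonometric polynomials do
    not see. *)
Lemma cliff_avg_shift (g : R -> R) (z : int) : trig2 g ->
  cliff_avg (fun t => g (t + z%:~R * (pi / 2))) = cliff_avg g.
Proof.
have key f : trig2 f -> cliff_avg (fun t => f (t + pi / 2)) = cliff_avg f.
  move=> [a0 [a1 [a2 [a3 [a4 Ef]]]]].
  rewrite !cliff_avgE !Ef !cosDpihalf !sinDpihalf cos0 sin0 cos_pihalf sin_pihalf
    cospi sinpi cos3pihalf sin3pihalf; ring.
have keyn (n : nat) f : trig2 f -> cliff_avg (fun t => f (t + n%:R * (pi / 2))) = cliff_avg f.
  elim: n => [|n IH] tf; first by under eq_fun do rewrite mul0r addr0.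
  rewrite -[RHS]IH // -[RHS]key; last exact: trig2_shift.
  by congr cliff_avg; apply/funext => t; congr f; rewrite -natr1; ring.
case: z => n tg; first exact: keyn.
(* A negative shift: the positive case is applied to the shifted function and cancels its shift. *)
rewrite -(keyn n.+1); last exact: trig2_shift.
congr cliff_avg; apply/funext => t; congr g.
by rewrite NegzE intrN mulNr addrK.
Qed.

(** In the averaged coordinates the translation is absorbed by shift invariance; in the others it
    moves the base point. *)
Lemma iter_cliff_avg_translate s F (z : 'I_m -> int) x : coord_trig2 F ->
  let y := \row_k ((z k)%:~R * (pi / 2)) in
  iter_avg (@cliff_avg R) s (fun v => F (v + y)) x
  = iter_avg (@cliff_avg R) s F (x + y).
Proof.
move=> tF y; elim: s x => [|k s IH] //= x.
under eq_fun do rewrite IH upd_add mxE.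
rewrite (@cliff_avg_shift (fun t => iter_avg (@cliff_avg R) s F (upd (x + y) k t))) //.
exact: iter_cliff_avg_trig2.
Qed.

Lemma iter_avg_unit A s F x :
  (forall f, (forall t, 0 <= f t <= 1) -> 0 <= A f <= 1) ->
  (forall y, 0 <= F y <= 1) -> 0 <= iter_avg A s F x <= 1.
Proof. by move=> A01 F01; elim: s x => [|k s IH] //= x; apply: A01. Qed.

(** Abstract in [A] and [D] to serve both parts: uniform averages with [D] the interval, four-point
    averages with [D] the four angles. *)
Lemma iter_cliff_avg_le A (D : pred R) s F G x :
  (forall f, (forall t, 0 <= f t <= 1) -> 0 <= A f <= 1) ->
  (forall f g, (forall t, 0 <= f t <= 1) -> trig2 g ->
     (forall t, D t -> g t <= f t) -> cliff_avg g <= A f) ->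
  uniq s -> (forall y, 0 <= F y <= 1) -> coord_trig2 G ->
  (forall y, (forall k, k \in s -> D (y 0 k)) ->
     (forall k, k \notin s -> y 0 k = x 0 k) -> G y <= F y) ->
  iter_avg (@cliff_avg R) s G x <= iter_avg A s F x.
Proof.
move=> A01 Ale; elim: s x => [|k s IH] /= x.
  by move=> _ _ _ GF; exact: GF.
move=> /andP[ks us] F01 tG GF; apply: Ale.
- by move=> t; exact: iter_avg_unit.
- exact: iter_cliff_avg_trig2.
move=> t Dt; apply: IH => // y yD yx; apply: GF => l.
  rewrite inE => /predU1P[->|]; last exact: yD.
  by rewrite yx // mxE eqxx.
by rewrite inE negb_or => /andP[lk ls]; rewrite yx // mxE (negbTE lk).
Qed.

End IteratedAverages.

(** * Pauli strings and Clifford unitaries *)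

Section TensorMatrices.
Variables (R : realType) (n : nat).
Notation C := R[i].
Implicit Types (f g : 'I_n -> bool -> bool -> C).

Definition bits (x : 'I_(2 ^ n)) : {ffun 'I_n -> bool} := [ffun k : 'I_n => bit x k].

Lemma bit0 k : bit 0 k = false.
Proof. by rewrite /bit div0n. Qed.

Lemma bits_inj : injective bits.
Proof.
(* Stated for any number [p] of bits, so that the induction can strip the lowest bit. *)
suff bit_inj p x y : (x < 2 ^ p)%N -> (y < 2 ^ p)%N ->
    (forall k, (k < p)%N -> bit x k = bit y k) -> x = y.
  move=> x y /ffunP xy; apply: val_inj; apply: bit_inj (ltn_ord x) (ltn_ord y) _.
  by move=> k kn; have := xy (Ordinal kn); rewrite !ffunE.
elim: p x y => [|p IH] x y.
  by rewrite expn0 !ltnS !leqn0 => /eqP -> /eqP ->.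
move=> xp yp xy; rewrite (divn_eq x 2) (divn_eq y 2) !modn2.
have := xy 0%N isT; rewrite /bit expn0 !divn1 => ->.
congr (_ * _ + _)%N; apply: IH.
- by rewrite ltn_divLR // mulnC -expnS.
- by rewrite ltn_divLR // mulnC -expnS.
- by move=> k kp; have := xy k.+1 kp; rewrite /bit expnS !divnMA.
Qed.

Lemma bits_bij : bijective bits.
Proof.
apply: inj_card_bij; first exact: bits_inj.
by rewrite card_ffun card_bool !card_ord.
Qed.

(** Distributivity, with basis indices read as bit vectors. It reduces products and traces of tensor
    matrices to single-qubit sums. *)
Lemma sum_bits (F : 'I_n -> bool -> C) :
  \sum_x \prod_k F k (bit (x : 'I_(2 ^ n)) k) = \prod_k \sum_b F k b.
Proof.
rewrite bigA_distr_bigA /= (reindex bits) /=; last exact: onW_bij bits_bij.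
by apply: eq_bigr => x _; apply: eq_bigr => k _; rewrite ffunE.
Qed.

Definition tens_mx f : 'M[C]_(2 ^ n) :=
  \matrix_(x, y) \prod_k f k (bit x k) (bit y k).

Lemma eq_tens_mx f g : (forall k u v, f k u v = g k u v) -> tens_mx f = tens_mx g.
Proof. by move=> fg; apply/matrixP => x y; rewrite !mxE; apply: eq_bigr. Qed.

Lemma tens_mxM f g :
  tens_mx f *m tens_mx g = tens_mx (fun k u w => \sum_v f k u v * g k v w).
Proof.
apply/matrixP => x z; rewrite !mxE -sum_bits; apply: eq_bigr => y _.
by rewrite !mxE -big_split.
Qed.

Lemma tens_mxZ (s : 'I_n -> C) f :
  tens_mx (fun k u v => s k * f k u v) = (\prod_k s k) *: tens_mx f.
Proof. by apply/matrixP => x y; rewrite !mxE -big_split. Qed.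

Lemma tens_mx1 : tens_mx (fun _ u v => (u == v)%:R) = 1%:M.
Proof.
apply/matrixP => x y; rewrite !mxE; case: eqVneq => [->|xy].
  by rewrite big1 // => k _; rewrite eqxx.
have [k xyk] : exists k, bits x k != bits y k.
  by apply/existsP; apply: contraR xy => /existsPn xy; apply/eqP/bits_inj/ffunP
    => k; apply/eqP; have := xy k; rewrite negbK.
by rewrite (bigD1 k) //=; move: xyk; rewrite !ffunE => /negbTE ->; rewrite mul0r.
Qed.

Lemma tens_mx_tr f : \tr (tens_mx f) = \prod_k \sum_b f k b b.
Proof. by rewrite -sum_bits; apply: eq_bigr => x _; rewrite mxE. Qed.

End TensorMatrices.

Section Adjoint.
Variable R : realType.

Lemma adj_mulmx (p q r : nat) (A : 'M[R[i]]_(p, q)) (B : 'M[R[i]]_(q, r)) :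
  adj (A *m B) = adj B *m adj A.
Proof. by rewrite /adj (map_mxM (@conjc R)) trmx_mul. Qed.

Lemma adj_addmx (p q : nat) (A B : 'M[R[i]]_(p, q)) : adj (A + B) = adj A + adj B.
Proof. by apply/matrixP => x y; rewrite !mxE (rmorphD (@conjc R)). Qed.

Lemma adj_scalemx (p q : nat) (s : R[i]) (A : 'M[R[i]]_(p, q)) :
  adj (s *: A) = (s^*)%C *: adj A.
Proof. by apply/matrixP => x y; rewrite !mxE (rmorphM (@conjc R)). Qed.

Lemma adj_scalar1 (p : nat) : adj (1%:M : 'M[R[i]]_p) = 1%:M.
Proof. by rewrite /adj (map_mx1 (@conjc R)) trmx1. Qed.

End Adjoint.

Section Phases.
Variable R : realType.
Implicit Types s u : R[i].

Definition phase s : Prop := s = 1 \/ s = -1 \/ s = 'i%C \/ s = - 'i%C.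

Lemma phase1 : phase 1. Proof. by left. Qed.

Lemma phaseN s : phase s -> phase (- s).
Proof. by case=> [->|[->|[->|->]]]; rewrite ?opprK /phase; auto. Qed.

Lemma phaseMi s : phase s -> phase ('i%C * s).
Proof.
have ii : 'i%C * 'i%C = -1 :> R[i] by rewrite -expr2 sqr_i.
by case=> [->|[->|[->|->]]]; rewrite ?mulrN ?mulr1 ?ii ?opprK /phase; auto.
Qed.

Lemma phaseM s u : phase s -> phase u -> phase (s * u).
Proof.
by case=> [->|[->|[->|->]]] pu; rewrite ?mulNr ?mul1r //;
  do ?[apply: phaseN|apply: phaseMi].
Qed.

Lemma phase_conjM s : phase s -> (s^*)%C * s = 1.
Proof.
by case=> [->|[->|[->|->]]]; apply/eqP; rewrite eq_complex /=; apply/andP; split;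
  apply/eqP; ring.
Qed.

Lemma phase_conj s : phase s -> phase (s^*)%C.
Proof.
have ci : ('i%C : R[i])^*%C = - 'i%C.
  by apply/eqP; rewrite eq_complex /= oppr0 !eqxx.
have cN (z : R[i]) : ((- z)^*)%C = - (z^*)%C by exact: (rmorphN (@conjc R)).
by case=> [->|[->|[->|->]]]; rewrite ?cN ?conjc1 ?ci ?opprK /phase; auto.
Qed.

Lemma phase_prod (I : finType) (F : I -> R[i]) :
  (forall k, phase (F k)) -> phase (\prod_k F k).
Proof.
by move=> pF; elim/big_ind: _ => //; [exact: phase1|exact: phaseM].
Qed.

End Phases.

(** * Products, traces and Clifford conjugation of Pauli strings *)

Section PauliAlgebra.
Variable R : realType.
Notation C := R[i].

Lemma ord4P (Q : 'I_4 -> Prop) :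
  Q (@Ordinal 4 0 isT) -> Q (@Ordinal 4 1 isT) -> Q (@Ordinal 4 2 isT) ->
  Q (@Ordinal 4 3 isT) -> forall a, Q a.
Proof.
move=> Q0 Q1 Q2 Q3 [[|[|[|[|//]]]] lt4].
- by rewrite (_ : Ordinal lt4 = @Ordinal 4 0 isT) //; apply: val_inj.
- by rewrite (_ : Ordinal lt4 = @Ordinal 4 1 isT) //; apply: val_inj.
- by rewrite (_ : Ordinal lt4 = @Ordinal 4 2 isT) //; apply: val_inj.
- by rewrite (_ : Ordinal lt4 = @Ordinal 4 3 isT) //; apply: val_inj.
Qed.

Lemma sigmaM (a b : 'I_4) : exists (c : 'I_4) (s : C), phase s /\
  forall u w, \sum_v sigma R a u v * sigma R b v w = s * sigma R c u w.
Proof.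
have ii : 'i%C * 'i%C = -1 :> C by rewrite -expr2 sqr_i.
pose sol (c : 'I_4) (s : C) := forall u w,
  \sum_v sigma R a u v * sigma R b v w = s * sigma R c u w.
suff [c [s [ps cs]]] : exists c s, phase s /\ sol c s by exists c, s.
(* The witnesses are the Pauli multiplication table, with [b] running from 0 to 3 for each [a]. *)
rewrite /sol {sol}; move: a b; do 2 apply: ord4P; rewrite /sigma /=;
 [exists (@Ordinal 4 0 isT), 1|exists (@Ordinal 4 1 isT), 1
 |exists (@Ordinal 4 2 isT), 1|exists (@Ordinal 4 3 isT), 1
 |exists (@Ordinal 4 1 isT), 1|exists (@Ordinal 4 0 isT), 1
 |exists (@Ordinal 4 3 isT), 'i%C|exists (@Ordinal 4 2 isT), (- 'i%C)
 |exists (@Ordinal 4 2 isT), 1|exists (@Ordinal 4 3 isT), (- 'i%C)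
 |exists (@Ordinal 4 0 isT), 1|exists (@Ordinal 4 1 isT), 'i%C
 |exists (@Ordinal 4 3 isT), 1|exists (@Ordinal 4 2 isT), 'i%C
 |exists (@Ordinal 4 1 isT), (- 'i%C)|exists (@Ordinal 4 0 isT), 1];
 (split; [by rewrite /phase; auto|move=> [] []]);
 rewrite /= big_bool /= ?mulrN ?mulNr ?mulr1 ?mul1r ?mulr0 ?mul0r ?ii ?opprK ?oppr0
   ?addr0 ?add0r //.
Qed.

Lemma sigma_sqr (a : 'I_4) u w :
  \sum_v sigma R a u v * sigma R a v w = (u == w)%:R.
Proof.
have ii : 'i%C * 'i%C = -1 :> C by rewrite -expr2 sqr_i.
move: a; apply: ord4P; case: u; case: w; rewrite big_bool /sigma /=
 ?mulrN ?mulNr ?mulr1 ?mul1r ?mulr0 ?mul0r ?ii ?opprK ?oppr0 ?addr0 ?add0r //.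
Qed.

Lemma sigma_tr (a b : 'I_4) : a != b ->
  \sum_u \sum_v sigma R a u v * sigma R b v u = 0.
Proof.
move: a b; do 2 apply: ord4P => //; rewrite !big_bool /sigma /=
 ?mulrN ?mulNr ?mulr1 ?mul1r ?mulr0 ?mul0r ?opprK ?oppr0 ?addr0 ?add0r ?addrN ?addNr //.
Qed.

Lemma conj_sigma (a : 'I_4) u v : (sigma R a v u)^*%C = sigma R a u v.
Proof.
move: a; apply: ord4P; case: u; case: v; apply/eqP;
  by rewrite eq_complex /sigma /= ?oppr0 ?opprK !eqxx.
Qed.

Variable n : nat.
Implicit Types P Q : pauli n.
Notation pmx := (@pauli_mx R n).

Lemma pauli_mxE P : pmx P = tens_mx (fun k => sigma R (P k)).
Proof. by apply/matrixP => x y; rewrite !mxE. Qed.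

Lemma pauli_mxM P Q : exists (T : pauli n) (s : C),
  phase s /\ pmx P *m pmx Q = s *: pmx T.
Proof.
have /boolp.choice[T hT] k := sigmaM (P k) (Q k).
have /boolp.choice[s hs] := hT.
exists [ffun k => T k], (\prod_k s k); split.
  by apply: phase_prod => k; case: (hs k).
rewrite !pauli_mxE tens_mxM -tens_mxZ; apply: eq_tens_mx => k u v.
by rewrite ffunE; case: (hs k).
Qed.

Lemma pauli_mx_sqr P : pmx P *m pmx P = 1%:M.
Proof.
by rewrite pauli_mxE tens_mxM -tens_mx1; apply: eq_tens_mx => k u v;
  rewrite sigma_sqr.
Qed.

Lemma adj_pauli_mx P : adj (pmx P) = pmx P.
Proof.
apply/matrixP => x y; rewrite !mxE (rmorph_prod (@conjc R)).
by apply: eq_bigr => k _; exact: conj_sigma.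
Qed.

Lemma pauli_mx_tr P Q : P != Q -> \tr (pmx P *m pmx Q) = 0.
Proof.
move=> PQ; rewrite !pauli_mxE tens_mxM tens_mx_tr.
have [k Pk] : exists k, P k != Q k.
  by apply/existsP; apply: contraR PQ => /existsPn PQ; apply/eqP/ffunP => k;
    apply/eqP; have := PQ k; rewrite negbK.
by rewrite (bigD1 k) //= sigma_tr // mul0r.
Qed.

(** Distinct strings are orthogonal for the trace, so [P != Q] would make [s] times the dimension
    zero. *)
Lemma pauli_mx_inj P Q s : s != 0 -> pmx P = s *: pmx Q -> P = Q.
Proof.
move=> s0 PsQ; apply/eqP; apply: contraNT s0 => /pauli_mx_tr.
rewrite PsQ -scalemxAl pauli_mx_sqr mxtraceZ mxtrace1 => /eqP.
by rewrite mulf_eq0 pnatr_eq0 expn_eq0 /= orbF.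
Qed.

(** If [P Q] is [s T], its adjoint [Q P] is [T] times the conjugate of [s]: a real phase gives
    commutation, an imaginary one anticommutation. *)
Lemma pauli_mx_commute P Q :
  pmx Q *m pmx P = pmx P *m pmx Q \/ pmx Q *m pmx P = - (pmx P *m pmx Q).
Proof.
have [T [s [ps E]]] := pauli_mxM P Q.
have -> : pmx Q *m pmx P = s^*%C *: pmx T.
  by rewrite -{1}(adj_pauli_mx Q) -{1}(adj_pauli_mx P) -adj_mulmx E adj_scalemx adj_pauli_mx.
have ci : ('i%C : C)^*%C = - 'i%C.
  by apply/eqP; rewrite eq_complex /= oppr0 !eqxx.
have cN (z : C) : ((- z)^*)%C = - (z^*)%C by exact: (rmorphN (@conjc R)).
rewrite E -scaleNr.
by case: ps => [->|[->|[->|->]]]; rewrite ?cN ?conjc1 ?ci ?opprK; auto.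
Qed.

Definition pauli_phase (A : 'M[C]_(2 ^ n)) : Prop :=
  exists (P : pauli n) (s : C), phase s /\ A = s *: pmx P.

(* Heisenberg picture, U^dagger P U, whereas [clifford] is about U P U^dagger. *)
Definition pauli_preserving (U : 'M[C]_(2 ^ n)) : Prop :=
  forall P, pauli_phase (adj U *m pmx P *m U).

Lemma pauli_phaseZ s A : phase s -> pauli_phase A -> pauli_phase (s *: A).
Proof.
move=> ps [P [u [pu ->]]]; exists P, (s * u); split; first exact: phaseM.
by rewrite scalerA.
Qed.

Lemma pauli_preserving1 : pauli_preserving 1%:M.
Proof.
move=> P; rewrite adj_scalar1 mulmx1 mul1mx; exists P, 1; split; first exact: phase1.
by rewrite scale1r.
Qed.

Lemma pauli_preservingM U V :
  pauli_preserving U -> pauli_preserving V -> pauli_preserving (U *m V).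
Proof.
move=> pU pV P; have [Q [s [ps E]]] := pU P.
rewrite adj_mulmx !mulmxA -(mulmxA (adj V)) -(mulmxA (adj V)) E.
by rewrite -scalemxAr -scalemxAl; exact: pauli_phaseZ.
Qed.

(** The induced map [T] on Pauli strings is injective on a finite set, hence bijective, so every [P]
    is an image and conjugation can be inverted. *)
Lemma clifford_preserving U : clifford U -> pauli_preserving U.
Proof.
move=> [uU cU]; have uU' := mulmx1C uU.
have /boolp.choice[T hT] := cU.
have /boolp.choice[s hs] := hT.
have ps P : phase (s P) by case: (hs P).
have sN0 P : s P != 0.
  by apply: contra_eq_neq (phase_conjM (ps P)) => ->; rewrite mulr0 eq_sym oner_eq0.
have PE P : pmx P = s P *: (adj U *m pmx (T P) *m U).
  rewrite scalemxAl scalemxAr -(proj2 (hs P)) !mulmxA uU' mul1mx.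
  by rewrite -mulmxA uU' mulmx1.
have Tinj : injective T.
  move=> P Q PQ; apply: (@pauli_mx_inj _ _ (s P / s Q)).
    by rewrite mulf_neq0 ?invr_eq0.
  by rewrite (PE P) (PE Q) PQ scalerA divfK.
have [T' _ TK] := injF_bij Tinj.
move=> P; exists (T' P), (s (T' P))^*%C; split; first exact: phase_conj.
by rewrite (PE (T' P)) TK scalerA phase_conjM // scale1r.
Qed.

End PauliAlgebra.

(** * Rotations and circuits *)

Section Circuits.
Variables (R : realType) (n : nat).
Notation C := R[i].
Notation pmx := (@pauli_mx R n).

Lemma quarter_turn_cos_sin (z : int) (t := z%:~R * (pi / 2) : R) :
  (sin t = 0 /\ (cos t = 1 \/ cos t = -1)) \/ (cos t = 0 /\ (sin t = 1 \/ sin t = -1)).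
Proof.
have nat_case (p : nat) (u := p%:R * (pi / 2) : R) :
  (sin u = 0 /\ (cos u = 1 \/ cos u = -1)) \/ (cos u = 0 /\ (sin u = 1 \/ sin u = -1)).
  rewrite {}/u; elim: p => [|p IH]; first by rewrite mul0r sin0 cos0; left; auto.
  rewrite -natr1 mulrDl mul1r sinDpihalf cosDpihalf.
  by case: IH => [[-> [] ->]|[-> [] ->]]; rewrite ?oppr0 ?opprK; auto.
rewrite {}/t; case: z => p; first exact: nat_case.
rewrite NegzE rmorphN /= mulNr sinN cosN.
by case: (nat_case p.+1) => [[-> [] ->]|[-> [] ->]]; rewrite ?oppr0 ?opprK; auto.
Qed.

(** Adding [pi] to the angle adds a quarter turn to its half, which exchanges sine and cosine up to
    sign. *)
Lemma rot_mx_add (Q : pauli n) (u t : R) :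
  rot_mx Q (u + t) = (cos (t / 2))%:C%C *: rot_mx Q u
                     + (sin (t / 2))%:C%C *: rot_mx Q (u + pi).
Proof.
have rcD (x y : R) : (x + y)%:C%C = x%:C%C + y%:C%C by exact: rmorphD.
have rcN (x : R) : (- x)%:C%C = - x%:C%C by exact: rmorphN.
have rcM (x y : R) : (x * y)%:C%C = x%:C%C * y%:C%C by exact: rmorphM.
rewrite /rot_mx !(mulrDl u) cosDpihalf sinDpihalf cosD sinD !rcD rcN !rcM.
rewrite !scalerBr !scalerA addrACA -!scalerDl -opprD -scalerDl.
congr (_ *: _ - _ *: _); ring.
Qed.

Lemma rot_mxM (Q : pauli n) (u t : R) : rot_mx Q u *m rot_mx Q t = rot_mx Q (u + t).
Proof.
have ii : 'i%C * 'i%C = -1 :> C by rewrite -expr2 sqr_i.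
have rcD (x y : R) : (x + y)%:C%C = x%:C%C + y%:C%C by exact: rmorphD.
have rcN (x : R) : (- x)%:C%C = - x%:C%C by exact: rmorphN.
have rcM (x y : R) : (x * y)%:C%C = x%:C%C * y%:C%C by exact: rmorphM.
rewrite /rot_mx mulmxBr !mulmxBl -!scalemxAl -!scalemxAr mul1mx !mulmx1 mul1mx.
rewrite pauli_mx_sqr !scalerA (mulrDl u) cosD sinD !rcD rcN !rcM mulrACA ii.
rewrite mulN1r scaleNr.
rewrite opprK [X in _ - X]addrC opprD addrACA -opprD -scalerBl -scalerDl.
by congr (_ *: _ - _ *: _); ring.
Qed.

Lemma adj_rot_mx (Q : pauli n) (t : R) : adj (rot_mx Q t) = rot_mx Q (- t).
Proof.
have ci : ('i%C : C)^*%C = - 'i%C.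
  by apply/eqP; rewrite eq_complex /= oppr0 !eqxx.
have cM (z w : C) : ((z * w)^*)%C = (z^*)%C * (w^*)%C by exact: (rmorphM (@conjc R)).
have cN (z : C) : ((- z)^*)%C = - (z^*)%C by exact: (rmorphN (@conjc R)).
have rcN (x : R) : (- x)%:C%C = - x%:C%C by exact: rmorphN.
rewrite /rot_mx -!scaleNr adj_addmx !adj_scalemx adj_scalar1 adj_pauli_mx.
by rewrite mulNr cosN sinN rcN conjc_real cN cM conjc_real ci mulrN mulNr !opprK.
Qed.

Lemma rot_mx0 (Q : pauli n) : rot_mx Q (0 : R) = 1%:M.
Proof. by rewrite /rot_mx mul0r cos0 sin0 mulr0 scale0r subr0 scale1r. Qed.

Lemma rot_mx_unitary (Q : pauli n) (t : R) : unitary (rot_mx Q t).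
Proof. by rewrite /unitary adj_rot_mx rot_mxM subrr rot_mx0. Qed.

(** A string commuting with [Q] is fixed. For an anticommuting one the left rotation passes through
    [P] and doubles the right one, giving [cos t] times [P] minus [i sin t] times [P Q]; at quarter
    turns one of the two terms vanishes. *)
Lemma rot_mx_preserving (Q : pauli n) (z : int) :
  pauli_preserving (rot_mx Q (z%:~R * (pi / 2) : R)).
Proof.
move=> P; set t := _ * _.
have uR := mulmx1C (rot_mx_unitary Q t).
have [QP|QP] := pauli_mx_commute R P Q.
  have -> : adj (rot_mx Q t) *m pmx P = pmx P *m adj (rot_mx Q t).
    rewrite adj_rot_mx /rot_mx mulmxBl mulmxBr -!scalemxAl -!scalemxAr QP.
    by rewrite mul1mx mulmx1.
  by rewrite -mulmxA uR mulmx1; exists P, 1; split; [exact: phase1|rewrite scale1r].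
have -> : adj (rot_mx Q t) *m pmx P = pmx P *m rot_mx Q t.
  rewrite adj_rot_mx /rot_mx mulmxBl mulmxBr -!scalemxAl -!scalemxAr QP.
  have rcN (x : R) : (- x)%:C%C = - x%:C%C by exact: rmorphN.
  by rewrite mul1mx mulmx1 scalerN mulNr cosN sinN rcN mulrN scaleNr !opprK.
have -> : pmx P *m rot_mx Q t *m rot_mx Q t =
    (cos t)%:C%C *: pmx P - ('i%C * (sin t)%:C%C) *: (pmx P *m pmx Q).
  rewrite -mulmxA rot_mxM /rot_mx mulmxBr -!scalemxAr mulmx1.
  by have -> : (t + t) / 2 = t by field.
have [T [s [ps ->]]] := pauli_mxM R P Q.
case: (quarter_turn_cos_sin z); rewrite -/t.
  case=> -> [] ->; rewrite mulr0 scale0r subr0.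
    by exists P, 1; split; first exact: phase1.
  exists P, (-1); split; [exact/phaseN/phase1|].
    by congr (_ *: _); exact: rmorphN1.
case=> -> [] ->; rewrite scale0r add0r scalerA -scaleNr.
  exists T, (- ('i%C * s)); split; first by apply/phaseN/phaseMi.
  by rewrite mulr1.
exists T, ('i%C * s); split; first by apply/phaseMi.
by rewrite rmorphN mulrN mulNr opprK mulr1.
Qed.
End Circuits.

(** * Half-angle functions and the parameter-shift rule *)

Section HalfAngle.
Variables (R : realType) (m : nat).
Implicit Types (F G : 'rV[R]_m -> R) (x y : 'rV[R]_m) (k l : 'I_m) (t : R).

(** The coefficients are values of [F] itself, at the point and half a turn away, which makes the
    condition stable under translation. *)
Definition half_angle F : Prop := forall k x t,
  F (x + t *: unitv R k) = cos (t / 2) * F x + sin (t / 2) * F (x + pi *: unitv R k).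

(** The parameter-shift formula for a partial derivative, exact in first degree. *)
Definition shift_diff k F x : R :=
  (F (x + (pi / 2) *: unitv R k) - F (x + (- (pi / 2)) *: unitv R k)) / 2.

Lemma shiftE x k t l : (x + t *: unitv R k) 0 l = x 0 l + (if l == k then t else 0).
Proof. by rewrite !mxE eqxx /=; case: eqP; rewrite ?mulr1 ?mulr0. Qed.

Lemma shift_upd x k t : x + t *: unitv R k = upd x k (x 0 k + t).
Proof.
by apply/rowP => l; rewrite shiftE mxE; case: eqP => [->|]; rewrite ?addr0.
Qed.

Lemma upd_shift x k t : upd x k t = upd x k 0 + t *: unitv R k.
Proof. by apply/rowP => l; rewrite shiftE !mxE; case: eqP; rewrite ?addr0 ?add0r. Qed.

Lemma half_angle_translate F y : half_angle F -> half_angle (fun x => F (x + y)).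
Proof.
by move=> hF k x t; rewrite !(addrAC x _ y) hF.
Qed.

Lemma cos_halfE t : cos t = cos (t / 2) ^+ 2 - sin (t / 2) ^+ 2.
Proof. by rewrite [in LHS](splitr t) cosD !expr2. Qed.

Lemma sin_halfE t : sin t = 2 * (sin (t / 2) * cos (t / 2)).
Proof. by rewrite [in LHS](splitr t) sinD; ring. Qed.

Lemma half_angleM_trig1 F G :
  half_angle F -> half_angle G -> coord_trig1 (fun x => F x * G x).
Proof.
move=> hF hG k x; pose y := upd x k 0; pose y' := y + pi *: unitv R k.
exists ((F y * G y + F y' * G y') / 2), ((F y * G y - F y' * G y') / 2),
  ((F y * G y' + F y' * G y) / 2) => t.
rewrite upd_shift -/y hF hG -/y' (cos_halfE t) (sin_halfE t).
have := cos2Dsin2 (t / 2); set c := cos _; set s := sin _ => cs.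
have E : s * s = 1 - c ^+ 2 by rewrite -cs; ring.
transitivity (c ^+ 2 * (F y * G y) + s * c * (F y * G y' + F y' * G y)
  + s * s * (F y' * G y')); first by ring.
by rewrite (expr2 s) E; field.
Qed.

(** The Leibniz rule: the derivative of a half-angle function is half its value after a shift by
    [pi]. *)
Lemma shift_diffM F G k x : half_angle F -> half_angle G ->
  shift_diff k (fun y => F y * G y) x =
  (F x * G (x + pi *: unitv R k) + F (x + pi *: unitv R k) * G x) / 2.
Proof.
move=> hF hG; rewrite /shift_diff !(hF k x (pi / 2), hF k x (- (pi / 2)), hG k x (pi / 2), hG k x (- (pi / 2))).
rewrite mulNr cosN sinN.
have := sin_pihalf R; rewrite (sin_halfE (pi / 2)).
set c := cos _; set s := sin _ => cs.
move: (F x) (F (x + _)) (G x) (G (x + _)) => u u' v v'.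
transitivity (2 * (s * c) * ((u * v' + u' * v) / 2)); first by field.
by rewrite cs mul1r.
Qed.

Lemma trig1D (f g : R -> R) : trig1 f -> trig1 g -> trig1 (fun t => f t + g t).
Proof.
move=> [a0 [a1 [a2 Ef]]] [b0 [b1 [b2 Eg]]].
by exists (a0 + b0), (a1 + b1), (a2 + b2) => t; rewrite Ef Eg; ring.
Qed.

Lemma trig1Z (c : R) (f : R -> R) : trig1 f -> trig1 (fun t => c * f t).
Proof.
move=> [a0 [a1 [a2 Ef]]].
by exists (c * a0), (c * a1), (c * a2) => t; rewrite Ef; ring.
Qed.

Lemma trig1_shift (f : R -> R) u : trig1 f -> trig1 (fun t => f (t + u)).
Proof.
move=> [a0 [a1 [a2 Ef]]].
exists a0, (a1 * cos u + a2 * sin u), (a2 * cos u - a1 * sin u) => t.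
by rewrite Ef cosD sinD; ring.
Qed.

Lemma coord_trig1_sum (I : Type) (r : seq I) (p : pred I) (F : I -> 'rV[R]_m -> R) :
  (forall i, coord_trig1 (F i)) -> coord_trig1 (fun x => \sum_(i <- r | p i) F i x).
Proof.
move=> tF k x; elim: r => [|i r IH].
  by exists 0, 0, 0 => t; rewrite big_nil !mul0r !addr0.
under eq_fun do rewrite big_cons.
by case: (p i) => //; apply: trig1D => //; exact: tF.
Qed.

Lemma coord_trig1_shift_diff F k : coord_trig1 F -> coord_trig1 (shift_diff k F).
Proof.
move=> tF l x.
have tF' y : trig1 (fun t => F (upd x l t + y)).
  under eq_fun do rewrite upd_add.
  exact: (trig1_shift (y 0 l) (tF l (x + y))).
have := trig1Z 2^-1 (trig1D (tF' ((pi / 2) *: unitv R k))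
  (trig1Z (-1) (tF' ((- (pi / 2)) *: unitv R k)))).
by congr trig1; apply/funext => t; rewrite /shift_diff mulN1r mulrC.
Qed.

(** Quarter turns forward and backward turn sine and cosine into plus and minus their derivatives,
    and the constant term cancels. *)
Lemma partial_trig1 F k x : coord_trig1 F -> partial k F x = shift_diff k F x.
Proof.
move=> tF; have [a0 [a1 [a2 E]]] := tF k x.
have {}E t : F (x + t *: unitv R k) = a0 + a1 * cos (x 0 k + t) + a2 * sin (x 0 k + t).
  by rewrite shift_upd E.
rewrite /partial /shift_diff !E; under eq_fun do rewrite E.
rewrite cosDpihalf cosBpihalf sinDpihalf sinBpihalf.
rewrite derive1E.
have -> : (a0 + a1 * - sin (x 0 k) + a2 * cos (x 0 k) -
   (a0 + a1 * sin (x 0 k) + a2 * - cos (x 0 k))) / 2 =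
   a2 * cos (x 0 k) - a1 * sin (x 0 k) by field.
apply: derive_val.
apply: is_derive_eq.
rewrite /GRing.scale /= !addr0; ring.
Qed.

End HalfAngle.

(** * Circuit amplitudes and expectation values *)

Section CircuitAmplitudes.
Variables (R : realType) (n m : nat).
Notation C := R[i].
Notation pmx := (@pauli_mx R n).
Implicit Types (g : gate R n m) (gs : seq (gate R n m)) (x y z : 'rV[R]_m) (k : 'I_m).

Lemma circ_mx_rcons gs g x :
  circ_mx (rcons gs g) x = gate_mx g x *m circ_mx gs x.
Proof. by rewrite /circ_mx -cats1 foldl_cat. Qed.

Lemma gate_mx_agree g x y k : ~~ is_rot_on k g ->
  (forall l, l != k -> y 0 l = x 0 l) -> gate_mx g y = gate_mx g x.
Proof. by case: g => [//|Q l] /= lk yx; rewrite yx. Qed.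

Lemma circ_mx_agree gs x y k : count (is_rot_on k) gs = 0%N ->
  (forall l, l != k -> y 0 l = x 0 l) -> circ_mx gs y = circ_mx gs x.
Proof.
move=> + yx; elim/last_ind: gs => [//|gs g IH].
rewrite -cats1 count_cat cats1 => /eqP.
rewrite addn_eq0 /= addn0 eqb0 => /andP[/eqP c0 gk].
by rewrite !circ_mx_rcons (IH c0) (gate_mx_agree gk yx).
Qed.

(** The circuit is linear in its only rotation on [k], so the relation for that gate carries
    over. *)
Lemma circ_mx_half_angle gs x y z k (t : R) : count (is_rot_on k) gs = 1%N ->
  (forall l, l != k -> y 0 l = x 0 l) -> (forall l, l != k -> z 0 l = x 0 l) ->
  y 0 k = x 0 k + t -> z 0 k = x 0 k + pi ->
  circ_mx gs y = (cos (t / 2))%:C%C *: circ_mx gs x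
                 + (sin (t / 2))%:C%C *: circ_mx gs z.
Proof.
move=> + yx zx ykE zkE; elim/last_ind: gs => [//|gs g IH].
rewrite -cats1 count_cat cats1 !circ_mx_rcons [count _ [:: g]]/= addn0.
case: (boolP (is_rot_on k g)) => [gk|gk]; last first.
  rewrite addn0 => /IH ->.
  rewrite (gate_mx_agree gk yx) (gate_mx_agree gk zx).
  move: (circ_mx gs x) (circ_mx gs z) (gate_mx g x) => A B G.
  by rewrite mulmxDr -!scalemxAr.
(* The last gate rotates [k] and no earlier one does: the earlier product is the same at all three
   points. *)
rewrite addn1 => -[] c0; rewrite (circ_mx_agree c0 yx) (circ_mx_agree c0 zx).
case: g gk => [//|Q l] /eqP ->; rewrite /gate_mx; move: (circ_mx gs x) => A.
rewrite ykE zkE rot_mx_add.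
move: (rot_mx Q (x 0 k)) (rot_mx Q (x 0 k + pi)) => U U'.
by rewrite mulmxDl -!scalemxAl.
Qed.

Definition origin : 'I_(2 ^ n) := Ordinal (expn_gt0 2 n).

(** Coordinate [r] of the vector [T U V |0>], where [T] will be the identity, a Pauli matrix or
    twice a projector. *)
Definition amplitude (T V : 'M[C]_(2 ^ n)) gs (r : 'I_(2 ^ n)) x : C :=
  (T *m (circ_mx gs x *m V)) r origin.

Lemma amplitude_half_angle T V gs r : (forall k, count (is_rot_on k) gs = 1%N) ->
  half_angle (fun x => complex.Re (amplitude T V gs r x)) /\
  half_angle (fun x => complex.Im (amplitude T V gs r x)).
Proof.
move=> gs1.
have E k x t : amplitude T V gs r (x + t *: unitv R k) =
    (cos (t / 2))%:C%C * amplitude T V gs r x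
    + (sin (t / 2))%:C%C * amplitude T V gs r (x + pi *: unitv R k).
  move yE : (x + t *: unitv R k) => y; move zE : (x + pi *: unitv R k) => z.
  have agree u l : l != k -> (x + u *: unitv R k) 0 l = x 0 l.
    by move=> /negbTE lk; rewrite shiftE lk addr0.
  rewrite /amplitude (@circ_mx_half_angle gs x y z k t).
  - move: (circ_mx gs x) (circ_mx gs z) => A B.
    by rewrite mulmxDl mulmxDr -!scalemxAl -!scalemxAr !mxE.
  - exact: gs1.
  - by move=> l; rewrite -yE; exact: agree.
  - by move=> l; rewrite -zE; exact: agree.
  - by rewrite -yE shiftE eqxx.
  - by rewrite -zE shiftE eqxx.
by split=> k x t; rewrite E; case: (amplitude T V gs r x) => a b;
  case: (amplitude T V gs r (x + _)) => c d /=; ring.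
Qed.

Lemma Re_adj_mulmx (p q s : nat) (A : 'M[C]_(q, p)) (B : 'M[C]_(q, s)) i j :
  complex.Re ((adj A *m B) i j) =
  \sum_r (complex.Re (A r i) * complex.Re (B r j)
          + complex.Im (A r i) * complex.Im (B r j)).
Proof.
rewrite mxE (raddf_sum (@complex.Re R)); apply: eq_bigr => r _.
by rewrite !mxE; case: (A r i) (B r j) => [a b] [c d] /=; ring.
Qed.

Lemma ell_entry V gs P x :
  ell (V *m ket0bra0 R n *m adj V) gs P x =
  complex.Re ((adj (circ_mx gs x *m V) *m (pmx P *m (circ_mx gs x *m V)))
    origin origin).
Proof.
rewrite /ell; congr complex.Re.
rewrite -!mulmxA mxtrace_mulC -!mulmxA adj_mulmx -!mulmxA.
set M := adj V *m _; rewrite /mxtrace (bigD1 origin) //= big1 ?addr0.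
  rewrite mxE (bigD1 origin) //= big1 ?addr0; first by rewrite mxE /= mul1r.
  move=> y y0; rewrite mxE; case: ifP => [/andP[_ /eqP y00]|_]; last by rewrite mul0r.
  by case/eqP: y0; apply: val_inj.
move=> y y0; rewrite mxE big1 // => z _; rewrite mxE.
case: ifP => [/andP[/eqP y00 _]|_]; last by rewrite mul0r.
by case/eqP: y0; apply: val_inj.
Qed.

Lemma ell_amplitude V gs P x :
  ell (V *m ket0bra0 R n *m adj V) gs P x =
  \sum_r (complex.Re (amplitude 1%:M V gs r x) * complex.Re (amplitude (pmx P) V gs r x)
          + complex.Im (amplitude 1%:M V gs r x) * complex.Im (amplitude (pmx P) V gs r x)).
Proof.
by rewrite ell_entry Re_adj_mulmx; apply: eq_bigr => r _; rewrite /amplitude mul1mx.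
Qed.

Lemma ell_trig1 V gs P : (forall k, count (is_rot_on k) gs = 1%N) ->
  coord_trig1 (ell (V *m ket0bra0 R n *m adj V) gs P).
Proof.
move=> gs1; rewrite (_ : ell _ _ _ = fun x => \sum_r
   (complex.Re (amplitude 1%:M V gs r x) * complex.Re (amplitude (pmx P) V gs r x)
   + complex.Im (amplitude 1%:M V gs r x) * complex.Im (amplitude (pmx P) V gs r x))).
  apply: coord_trig1_sum => r k x.
  have [hR hI] := @amplitude_half_angle 1%:M V gs r gs1.
  have [hR' hI'] := @amplitude_half_angle (pmx P) V gs r gs1.
  exact: (trig1D (half_angleM_trig1 hR hR' k x) (half_angleM_trig1 hI hI' k x)).
by apply/funext => x; rewrite ell_amplitude.
Qed.

Lemma unitaryM (U V : 'M[C]_(2 ^ n)) : unitary U -> unitary V -> unitary (U *m V).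
Proof.
move=> uU uV; rewrite /unitary adj_mulmx -mulmxA (mulmxA V) uV mul1mx; exact: uU.
Qed.

Lemma circ_mx_ind (Q : 'M[C]_(2 ^ n) -> Prop) gs x :
  Q 1%:M -> (forall U V, Q U -> Q V -> Q (U *m V)) ->
  (forall g, List.In g gs -> Q (gate_mx g x)) -> Q (circ_mx gs x).
Proof.
move=> Q1 QM; elim/last_ind: gs => [//|gs g IH] Qg.
rewrite circ_mx_rcons; apply: QM.
  by apply: Qg; rewrite -cats1; apply/List.in_or_app; right; left.
by apply: IH => h hgs; apply: Qg; rewrite -cats1; apply/List.in_or_app; left.
Qed.

Lemma circ_mx_unitary gs x : clifford_circuit gs -> unitary (circ_mx gs x).
Proof.
move=> [cl _]; apply: circ_mx_ind.
- by rewrite /unitary adj_scalar1 mulmx1.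
- exact: unitaryM.
- by move=> [M|Q k] /cl; [case|move=> _; exact: rot_mx_unitary].
Qed.

Lemma circ_mx_preserving gs (w : 'I_m -> int) x : clifford_circuit gs ->
  (forall k, x 0 k = (w k)%:~R * (pi / 2)) -> pauli_preserving (circ_mx gs x).
Proof.
move=> [cl _] xz; apply: circ_mx_ind.
- exact: pauli_preserving1.
- exact: pauli_preservingM.
- move=> [M|Q k] /cl /=; first exact: clifford_preserving.
  by move=> _; rewrite xz; exact: rot_mx_preserving.
Qed.

Lemma pauli_mx_origin P : pmx P origin origin = 0 \/ pmx P origin origin = 1.
Proof.
rewrite mxE /=; elim/big_ind: _ => [|a b [->|->] [->|->]|k _]; rewrite ?mulr0 ?mul0r ?mulr1; auto.
by rewrite bit0; move: (P k); apply: ord4P; rewrite /sigma /=; auto.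
Qed.

(** Conjugation yields a phase times a Pauli string, whose entry at the origin is 0 or 1; imaginary
    phases vanish in the real part. *)
Lemma ell_stabilizer V gs P (w : 'I_m -> int) x : clifford V -> clifford_circuit gs ->
  (forall k, x 0 k = (w k)%:~R * (pi / 2)) ->
  let e := ell (V *m ket0bra0 R n *m adj V) gs P x in e = 0 \/ e ^+ 2 = 1.
Proof.
move=> cV cgs xz /=; rewrite ell_entry.
have := pauli_preservingM (circ_mx_preserving cgs xz) (clifford_preserving cV) P.
move=> [Q [s [ps]]]; rewrite -mulmxA => ->; rewrite mxE.
case: (pauli_mx_origin Q) => ->; first by rewrite mulr0; left.
rewrite mulr1; case: ps => [->|[->|[->|->]]] /=; rewrite ?oppr0 ?sqrrN ?expr1n; auto.
Qed.

(** [T] is self-adjoint with [T T = 2 T], so for the unitary [W = U V] the squared norm of [T W |0>]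
    is twice the expectation of [T]. *)
Lemma ell_excess V gs P x (s : R) : unitary V -> clifford_circuit gs -> s ^+ 2 = 1 ->
  let T := 1%:M + s%:C%C *: pmx P in
  1 + s * ell (V *m ket0bra0 R n *m adj V) gs P x =
  2^-1 * \sum_r (complex.Re (amplitude T V gs r x) ^+ 2
                 + complex.Im (amplitude T V gs r x) ^+ 2).
Proof.
move=> uV cgs s2 T.
have uW := mulmx1C (unitaryM (circ_mx_unitary x cgs) uV).
have aT : adj T = T.
  by rewrite /T adj_addmx adj_scalemx adj_scalar1 adj_pauli_mx conjc_real.
have TT : T *m T = T + T.
  rewrite {1 2}/T mulmxDl mul1mx mulmxDr mulmx1 -!scalemxAl -!scalemxAr.
  rewrite pauli_mx_sqr scalerA -rmorphM /= -expr2 s2 scale1r.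
  by rewrite (addrC (_ *: pmx P)).
have -> : \sum_r (complex.Re (amplitude T V gs r x) ^+ 2
                 + complex.Im (amplitude T V gs r x) ^+ 2) =
    complex.Re ((adj (T *m (circ_mx gs x *m V)) *m (T *m (circ_mx gs x *m V))) origin origin).
  by rewrite Re_adj_mulmx.
rewrite ell_entry; move: (circ_mx gs x *m V) uW => W uW.
rewrite adj_mulmx aT !mulmxA -(mulmxA (adj W) T T) TT mulmxDr mulmxDl /T.
rewrite mulmxDr mulmx1 mulmxDl uW -scalemxAr -scalemxAl.
move: (adj W *m pmx P *m W) => M; rewrite !mxE eqxx /=.
by case: (M origin origin) => a b /=; field.
Qed.

End CircuitAmplitudes.

(** * Local minima *)

Section Criterion.
Variables (R : realType) (m : nat).
Implicit Types (F G f g : 'rV[R]_m -> R) (x y z : 'rV[R]_m) (k l : 'I_m).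

Lemma shift_diffD F G k x :
  shift_diff k (fun y => F y + G y) x = shift_diff k F x + shift_diff k G x.
Proof. by rewrite /shift_diff -mulrDl opprD addrACA. Qed.

Lemma shift_diff_affine (I : finType) (F : I -> 'rV[R]_m -> R) (w b : R) k x :
  shift_diff k (fun y => w * (\sum_i F i y) + b) x = w * \sum_i shift_diff k (F i) x.
Proof.
rewrite /shift_diff opprD addrACA subrr addr0 -mulrBr -sumrB -mulrA mulr_suml.
by congr (_ * _).
Qed.

Lemma half_angle_sqr_shift_diff F k : half_angle F ->
  shift_diff k (fun y => F y ^+ 2) = fun y => F y * F (y + pi *: unitv R k).
Proof.
move=> hF; apply/funext => y.
have -> : (fun y => F y ^+ 2) = (fun y => F y * F y) by apply/funext => z; rewrite expr2.
rewrite shift_diffM //; move: (F y) (F (y + _)) => u v; by field.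
Qed.

(** In the Leibniz rule the term keeping the factor [F y] vanishes; a product of two first-order
    shifts remains. *)
Lemma shift_diff2_zero F k l y : half_angle F -> F y = 0 ->
  shift_diff l (shift_diff k (fun y => F y ^+ 2)) y =
  F (y + pi *: unitv R k) * F (y + pi *: unitv R l) / 2.
Proof.
move=> hF F0; rewrite half_angle_sqr_shift_diff //.
rewrite (@shift_diffM _ _ F (fun z => F (z + pi *: unitv R k))) //; last first.
  exact: half_angle_translate.
by rewrite F0 mul0r add0r [F _ * _]mulrC.
Qed.

(* If f + |c| is a sum of squares of half-angle functions that vanish at y, its
   gradient at y is zero and its Hessian is a Gram matrix. *)
Lemma sum_sqr_critical (I : finType) (h : I -> 'rV[R]_m -> R) (w b : R) f y :
  0 <= w -> (forall i, half_angle (h i)) -> (forall i, h i y = 0) ->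
  (forall x, f x = w * (\sum_i h i x ^+ 2) + b) ->
  (forall k, shift_diff k f y = 0) /\
  (forall v : 'I_m -> R,
     0 <= \sum_k \sum_l v k * v l * shift_diff l (shift_diff k f) y).
Proof.
move=> w0 hh h0 /funext ->.
have D1 k : shift_diff k (fun x => w * (\sum_i h i x ^+ 2) + b) =
    fun x => w * (\sum_i shift_diff k (fun y => h i y ^+ 2) x) + 0.
  by apply/funext => x; rewrite shift_diff_affine addr0.
split=> [k|v].
  rewrite D1 big1 ?mulr0 ?addr0 // => i _.
  by rewrite half_angle_sqr_shift_diff // h0 mul0r.
have -> : \sum_k \sum_l v k * v l * shift_diff l
    (shift_diff k (fun x => w * (\sum_i h i x ^+ 2) + b)) y =
    w / 2 * \sum_i (\sum_k v k * h i (y + pi *: unitv R k)) ^+ 2.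
  under eq_bigr do under eq_bigr do rewrite D1 shift_diff_affine.
  (* The Gram vectors: Hessian entry [k, l] is [w / 2] times the sum over [i] of [u i k * u i l]. *)
  pose u i k := h i (y + pi *: unitv R k).
  transitivity (\sum_k \sum_l \sum_i w / 2 * (v k * u i k * (v l * u i l))).
    apply: eq_bigr => k _; apply: eq_bigr => l _.
    rewrite mulrA mulr_sumr; apply: eq_bigr => i _.
    rewrite shift_diff2_zero // -/(u i k) -/(u i l); by field.
  rewrite mulr_sumr exchange_big /=.
  under eq_bigr do rewrite exchange_big /=.
  rewrite exchange_big /=; apply: eq_bigr => i _.
  rewrite expr2 mulr_suml mulr_sumr exchange_big /=.
  by apply: eq_bigr => k _; rewrite mulr_sumr mulr_sumr.
by rewrite mulr_ge0 ?divr_ge0 ?sumr_ge0 // => i _; exact: sqr_ge0.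
Qed.

(** The two coordinates may coincide, and their turns then add up. There are [9 m^2] indices. *)
Definition shift_index : finType := ('I_m * 'I_m * ('I_3 * 'I_3))%type.

(* Quarter turns by -1, 0 or 1 (encoded as 0, 1, 2 in 'I_3) in two coordinates. *)
Definition shift_int (q : shift_index) (k : 'I_m) : int :=
  (if k == q.1.1 then q.2.1%:Z - 1 else 0) + (if k == q.1.2 then q.2.2%:Z - 1 else 0).

Definition shift_vec (q : shift_index) : 'rV[R]_m :=
  \row_k ((shift_int q k)%:~R * (pi / 2)).

Lemma shift_vecE x k l (s t : 'I_3) :
  x + ((s%:Z - 1)%:~R * (pi / 2)) *: unitv R k + ((t%:Z - 1)%:~R * (pi / 2)) *: unitv R l
  = x + shift_vec (k, l, (s, t)).
Proof.
apply/rowP => j; rewrite !shiftE [RHS]mxE [X in _ = _ + X]mxE /shift_int /=.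
rewrite [in RHS]intrD [in RHS]mulrDl [in RHS]addrA.
by congr (_ + _ + _); case: (j == _); rewrite ?mul0r.
Qed.

Lemma shift_diff_le F k x (B : R) :
  `|F (x + (pi / 2) *: unitv R k)| <= B -> `|F (x + (- (pi / 2)) *: unitv R k)| <= B ->
  `|shift_diff k F x| <= B.
Proof.
rewrite /shift_diff; move: (F _) (F _) => u v.
by rewrite !ler_norml => ? ?; apply/andP; split; lra.
Qed.

(** All gradient and Hessian entries of [g] are at most [B] in absolute value, so [g] lowers the
    quadratic form of [f] by at most [m B |v|^2]. *)
Lemma approx_local_min_of_bound f g y (B eps : R) :
  coord_trig1 f -> coord_trig1 g ->
  (forall k, shift_diff k f y = 0) ->
  (forall v : 'I_m -> R,
     0 <= \sum_k \sum_l v k * v l * shift_diff l (shift_diff k f) y) ->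
  (forall q, `|g (y + shift_vec q)| <= B) ->
  B <= eps -> m%:R * B <= Num.sqrt eps ->
  approx_local_min eps (fun x => f x + g x) y.
Proof.
move=> tf tg f1 f2 gB Beps mB.
pose p1 : 'I_3 := @Ordinal 3 2 isT; pose p0 : 'I_3 := @Ordinal 3 1 isT.
pose pm : 'I_3 := @Ordinal 3 0 isT.
have e1 : ((p1%:Z - 1)%:~R * (pi / 2) : R) = pi / 2 by rewrite mul1r.
have e0 : ((p0%:Z - 1)%:~R * (pi / 2) : R) = 0 by rewrite mul0r.
have em : ((pm%:Z - 1)%:~R * (pi / 2) : R) = - (pi / 2) by rewrite mulN1r.
have tfg : coord_trig1 (fun x => f x + g x).
  by move=> k x; exact: trig1D (tf k x) (tg k x).
have D1 k : partial k (fun x => f x + g x) = fun x => shift_diff k f x + shift_diff k g x.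
  by apply/funext => x; rewrite partial_trig1 // shift_diffD.
have D2 k l : partial l (partial k (fun x => f x + g x)) y =
    shift_diff l (shift_diff k f) y + shift_diff l (shift_diff k g) y.
  rewrite D1 partial_trig1 ?shift_diffD //.
  by move=> j x; apply: trig1D; apply: coord_trig1_shift_diff.
have gB2 k l (s t : 'I_3) (u w : R) : (s%:Z - 1)%:~R * (pi / 2) = u ->
    (t%:Z - 1)%:~R * (pi / 2) = w -> `|g (y + u *: unitv R k + w *: unitv R l)| <= B.
  by move=> <- <-; rewrite shift_vecE.
have gB1 k (s : 'I_3) (u : R) : (s%:Z - 1)%:~R * (pi / 2) = u ->
    `|g (y + u *: unitv R k)| <= B.
  by move=> su; have := gB2 k k s p0 u 0 su e0; rewrite scale0r addr0.
have g2 k l : `|shift_diff l (shift_diff k g) y| <= B.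
  apply: shift_diff_le; apply: shift_diff_le.
  - exact: (gB2 _ _ _ _ _ _ e1 e1).
  - exact: (gB2 _ _ _ _ _ _ e1 em).
  - exact: (gB2 _ _ _ _ _ _ em e1).
  - exact: (gB2 _ _ _ _ _ _ em em).
have g1 k : `|shift_diff k g y| <= B.
  by apply: shift_diff_le; [exact: (gB1 _ _ _ e1)|exact: (gB1 _ _ _ em)].
split=> [k|a /eigenvalueP[v vH v0]].
  by rewrite D1 f1 add0r (le_trans (g1 k)).
pose V := \sum_l v 0 l ^+ 2.
have V0 : 0 < V.
  have [l vl] : exists l, v 0 l != 0 by apply/rV0Pn.
  rewrite /V (bigD1 l) //= ltr_wpDr ?sumr_ge0 // ?exprn_even_gt0 //.
  by move=> j _; exact: sqr_ge0.
(* The quadratic form at the eigenvector: [a] is its Rayleigh quotient. *)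
have EV : a * V = \sum_k \sum_l v 0 k * v 0 l * hessian (fun x => f x + g x) y k l.
  rewrite exchange_big /V mulr_sumr /=; apply: eq_bigr => l _.
  have /rowP/(_ l) := vH; rewrite !mxE => E.
  rewrite expr2 mulrA -E mulr_suml; apply: eq_bigr => k _.
  by rewrite -!mulrA; congr (_ * _); rewrite mulrC.
have lbV : - (m%:R * B) * V <= a * V.
  rewrite EV; under eq_bigr do under eq_bigr do rewrite mxE D2 mulrDr.
  under eq_bigr do rewrite big_split /=.
  rewrite big_split /= -[leLHS]add0r lerD // ?(f2 (v 0)) //.
  have -> : - (m%:R * B) * V =
      \sum_(k < m) \sum_(l < m) - (B * (v 0 k ^+ 2 + v 0 l ^+ 2) / 2).
    under eq_bigr do under eq_bigr do rewrite mulrDr mulrDl opprD.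
    under eq_bigr do rewrite big_split /= sumr_const card_ord.
    rewrite big_split /= sumr_const card_ord.
    have -> : \sum_(i < m) - (B * v 0 i ^+ 2 / 2) *+ m = - (m%:R * B / 2) * V.
      by rewrite /V mulr_sumr; apply: eq_bigr => k _; rewrite -mulr_natl; ring.
    have -> : \sum_(i < m) - (B * v 0 i ^+ 2 / 2) = - (B / 2) * V.
      by rewrite /V mulr_sumr; apply: eq_bigr => k _; ring.
    by rewrite -mulr_natl; field.
  apply: ler_sum => k _; apply: ler_sum => l _.
  have := g2 k l; move: (shift_diff l _ y) (v 0 k) (v 0 l) => d p r.
  rewrite ler_norml => /andP[dB Bd].
  (* Adding [h1] and [h2] gives [2 B (p^2 + r^2) + 4 d p r >= 0]. *)
  have h1 : 0 <= (B + d) * (p + r) ^+ 2 by rewrite mulr_ge0 ?sqr_ge0 //; lra.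
  have h2 : 0 <= (B - d) * (p - r) ^+ 2 by rewrite mulr_ge0 ?sqr_ge0 //; lra.
  by nra.
apply: le_trans (_ : - (m%:R * B) <= a); first by rewrite lerN2.
by rewrite -(ler_pM2r V0).
Qed.

End Criterion.

(** * The loss near the chosen Clifford point *)

Section Landscape.
Variables (R : realType) (n N m : nat) (V : 'M[R[i]]_(2 ^ n)) (gs : seq (gate R n m)).
Variables (c : 'I_N -> R) (P : 'I_N -> pauli n) (i : 'I_N) (cmax : R).
Hypotheses (cV : clifford V) (cgs : clifford_circuit gs).
Hypothesis c_le : forall j, `|c j| <= cmax.
Notation L j := (ell (V *m ket0bra0 R n *m adj V) gs (P j)).
Implicit Types (x y : 'rV[R]_m) (k l : 'I_m).

(** A sum of squares rather than a maximum: it dominates each term, yet stays a trigonometric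
    polynomial with a computable average. *)
Definition shifted_weight x : R :=
  \sum_(p : 'I_N * shift_index m | p.1 != i) L p.1 (x + shift_vec R p.2) ^+ 2.

Lemma shifted_weight_ge0 x : 0 <= shifted_weight x.
Proof. by apply: sumr_ge0 => p _; exact: sqr_ge0. Qed.

Lemma le_shifted_weight (p : 'I_N * shift_index m) x : p.1 != i ->
  L p.1 (x + shift_vec R p.2) ^+ 2 <= shifted_weight x.
Proof.
move=> pi; rewrite /shifted_weight (bigD1 p) // lerDl.
by apply: sumr_ge0 => q _; exact: sqr_ge0.
Qed.

Lemma ell_critical y : c i * L i y = - `|c i| ->
  (forall k, shift_diff k (fun x => c i * L i x) y = 0) /\
  (forall v : 'I_m -> R,
     0 <= \sum_k \sum_l v k * v l * shift_diff l (shift_diff k (fun x => c i * L i x)) y).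
Proof.
move=> Ly; pose s := if c i < 0 then -1 else 1 : R.
have s2 : s ^+ 2 = 1 by rewrite /s; case: ifP; rewrite ?sqrrN expr1n.
have cs : c i = `|c i| * s.
  rewrite /s; case: ltP => ci; first by rewrite ltr0_norm // mulrN1 opprK.
  by rewrite ger0_norm // mulr1.
pose T := 1%:M + s%:C%C *: pauli_mx R (P i).
pose h (p : 'I_(2 ^ n) * bool) x : R :=
  if p.2 then complex.Re (amplitude T V gs p.1 x) else complex.Im (amplitude T V gs p.1 x).
have hE x : \sum_p h p x ^+ 2 = 2 * (1 + s * L i x).
  rewrite (ell_excess (P i) x (proj1 cV) cgs s2) mulVKf ?pnatr_eq0 //.
  rewrite -(pair_bigA _ (fun r b => h (r, b) x ^+ 2)) /=.
  by apply: eq_bigr => r _; rewrite big_bool.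
(* When [c i = 0] the hypothesis says nothing about [ell] and the squares need not vanish, but the
   function is identically zero. *)
have [c0|c0] := eqVneq (c i) 0.
  have f0 : (fun x => c i * L i x) = fun=> 0 by apply/funext => x; rewrite c0 mul0r.
  have D0 k : shift_diff k (fun=> 0) = (fun=> 0) :> ('rV[R]_m -> R).
    by apply/funext => x; rewrite /shift_diff subrr mul0r.
  rewrite f0; split=> [k|v]; first by rewrite D0.
  by rewrite sumr_ge0 // => k _; rewrite sumr_ge0 // => l _; rewrite !D0 mulr0.
have sL : 1 + s * L i y = 0.
  move: Ly; rewrite {1}cs -mulrA -[- _]mulrN1 => /mulfI.
  by rewrite normr_eq0 => /(_ c0) ->; rewrite addrN.
apply: (@sum_sqr_critical _ _ _ h (`|c i| / 2) (- `|c i|)).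
- by rewrite divr_ge0.
- move=> [r []]; have [hR hI] := @amplitude_half_angle _ _ _ T V gs r (proj2 cgs).
    exact: hR.
  exact: hI.
- move=> p; have := hE y; rewrite sL mulr0 => /eqP.
  rewrite psumr_eq0 => [/allP/(_ p)|q _]; last exact: sqr_ge0.
  by rewrite mem_index_enum sqrf_eq0 => /(_ isT)/eqP.
- by move=> x; rewrite hE {1}cs; field.
Qed.

(** The weight bound makes every shifted value of the other [ell] at most [d] in absolute value,
    hence the rest of the loss at most [N cmax d]. *)
Lemma approx_local_min_of_weight y (d eps : R) : 0 <= d ->
  c i * L i y = - `|c i| -> shifted_weight y <= d ^+ 2 ->
  N%:R * cmax * d <= eps -> m%:R * (N%:R * cmax * d) <= Num.sqrt eps ->
  approx_local_min eps (loss (V *m ket0bra0 R n *m adj V) gs c P) y.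
Proof.
move=> d0 Ly Zy Beps mB.
pose g x := \sum_(j < N | j != i) c j * L j x.
have -> : loss (V *m ket0bra0 R n *m adj V) gs c P = fun x => c i * L i x + g x.
  by apply/funext => x; rewrite /loss (bigD1 i).
have tL j : coord_trig1 (fun x => c j * L j x).
  by move=> k x; apply: trig1Z; exact: (ell_trig1 V (P j) (proj2 cgs) k x).
have [f1 f2] := ell_critical Ly.
apply: (@approx_local_min_of_bound _ _ _ g _ (N%:R * cmax * d)) => //.
  by apply: coord_trig1_sum => j.
move=> q; have Lq j : j != i -> `|L j (y + shift_vec R q)| <= d.
  move=> ji; rewrite -(@ler_pXn2r _ 2) ?nnegrE //.
  rewrite real_normK ?num_real //; apply: le_trans Zy.
  exact: (@le_shifted_weight (j, q)).
apply: le_trans (ler_norm_sum _ _ _) _.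
have cmax0 : 0 <= cmax by exact: le_trans (normr_ge0 _) (c_le i).
rewrite -mulrA -[N in N%:R]card_ord mulr_natl -sumr_const big_mkcond.
apply: ler_sum => j _; case: ifPn => [ji|_]; last by rewrite mulr_ge0.
by rewrite normrM ler_pM // Lq.
Qed.

(** Shifts keep quarter-turn points among themselves, so each summand is 0 or 1. *)
Lemma shifted_weight_clifford (z : 'I_m -> int) y :
  (forall k, y 0 k = (z k)%:~R * (pi / 2)) ->
  shifted_weight y <= 0 \/ 1 <= shifted_weight y.
Proof.
move=> yz.
have Ly (p : 'I_N * shift_index m) :
    L p.1 (y + shift_vec R p.2) = 0 \/ L p.1 (y + shift_vec R p.2) ^+ 2 = 1.
  apply: (@ell_stabilizer _ _ _ _ _ _ (fun k => z k + shift_int p.2 k)) => // k.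
  by rewrite mxE yz [X in _ + X]mxE -mulrDl -intrD.
have [p pi|L0] := pickP (fun p : 'I_N * shift_index m =>
    (p.1 != i) && (L p.1 (y + shift_vec R p.2) ^+ 2 == 1)).
  by case/andP: pi => pi /eqP <-; right; exact: le_shifted_weight.
left; rewrite /shifted_weight big1 // => p pi.
case: (Ly p) => [->|p1]; first by rewrite expr0n.
by have := L0 p; rewrite pi p1 eqxx.
Qed.

Variables (S : {set 'I_m}) (a : 'I_m -> 'I_4) (beta : R).
Hypothesis beta_ge0 : 0 <= beta.
Hypothesis second_moment : forall t : 'I_m -> int,
  (#|[set k in S | t k != 0]| <= 2)%N -> forall j, j != i ->
  E_unif S (fun x => L j x ^+ 2) (shifted_angles R S a t) <= beta.

Lemma sqr_ell_trig2 j : coord_trig2 (fun x => L j x ^+ 2).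
Proof. by move=> k x; apply: trig1_sqr; exact: (ell_trig1 V (P j) (proj2 cgs) k x). Qed.

Lemma affine_weight_trig2 (w : R) : coord_trig2 (fun x => 1 - w * shifted_weight x).
Proof.
move=> k x; apply: trig2D; first exact: trig2_cst.
under eq_fun do rewrite -mulNr.
apply: trig2Z; apply: trig2_sum => p.
exact: (coord_trig2_translate (shift_vec R p.2) (sqr_ell_trig2 p.1) k x).
Qed.

(** The translation moves to the base point, whose averaged coordinates are overwritten; only its
    components in [S] remain, and at most two of them are nonzero. *)
Lemma shifted_second_moment (p : 'I_N * shift_index m) : p.1 != i ->
  E_cliff S (fun x => L p.1 (x + shift_vec R p.2) ^+ 2) (cliff_angles R a) <= beta.
Proof.
move=> pi; have tL := sqr_ell_trig2 p.1.
rewrite /E_cliff (iter_cliff_avg_translate _ (shift_int p.2) _ tL).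
rewrite -iter_unif_avgE //.
apply: le_trans (second_moment (t := shift_int p.2) _ pi).
  rewrite /E_unif le_eqVlt; apply/orP; left; apply/eqP/eq_iter_avg => k.
  by rewrite mem_enum inE negbK => kS; rewrite !mxE kS mulrA.
case: p pi {tL} => j [[k l] st] _ /=.
apply: (@leq_trans #|[set k; l]|); last by rewrite cards2; case: (_ == _).
apply: subset_leq_card; apply/fintype.subsetP => r; rewrite !inE /shift_int /= => /andP[_].
by case: (r == k) => //; case: (r == l).
Qed.

Lemma E_affine_weight (w : R) : 0 <= w ->
  1 - w * (9%:R * N%:R * m%:R ^+ 2 * beta) <=
  E_cliff S (fun x => 1 - w * shifted_weight x) (cliff_angles R a).
Proof.
move=> w0; rewrite /E_cliff iter_cliff_avg_affine lerD2l lerN2 ler_wpM2l //.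
(* The pairs with first component [i] are counted too, each contributing [beta >= 0]; this gives the
   count [9 N m^2]. *)
apply: (@le_trans _ _ (\sum_(p : 'I_N * shift_index m) beta)).
  rewrite big_mkcond; apply: ler_sum => p _.
  by case: ifPn => // pi; exact: shifted_second_moment.
rewrite sumr_const -[leLHS]mulr_natl /shift_index !card_prod !card_ord.
by rewrite !natrM expr2; lra.
Qed.

End Landscape.

(** * Probability bounds for the two sampling schemes *)

Lemma indic_unit (R : realType) (T : Type) (E : set T) (x : T) :
  0 <= (\1_E x : R) <= 1.
Proof. by rewrite indicE ler0n lern1 leq_b1. Qed.

Theorem theorem2 :
  exists K d : nat,
  forall (R : realType) (n N m : nat) (rho : 'M[R[i]]_(2 ^ n))
    (gs : seq (gate R n m)) (c : 'I_N -> R) (P : 'I_N -> pauli n) (cmax : R)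
    (i : 'I_N) (S : {set 'I_m}) (a : 'I_m -> 'I_4) (C b : R),
    stabilizer_state rho ->
    clifford_circuit gs ->
    (forall j, `|c j| <= cmax) ->
    0 < C -> 1 < b ->
    (* 1. L_i(theta_i, phi) = -|c_i| for all phi in [0,2pi)^F *)
    (forall phi : 'rV[R]_m, (forall k, k \notin S -> 0 <= phi 0 k < pi *+ 2) ->
       c i * ell rho gs (P i) (join_pt S (cliff_angles R a) phi) = - `|c i|) ->
    (* 2. E_phi[ell_j(theta_i, phi)^2] <= C b^-n for j <> i *)
    (forall j, j != i ->
       E_unif S (fun x => ell rho gs (P j) x ^+ 2) (cliff_angles R a) <= C * b ^- n) ->
    (* 3. same bound at theta' = theta_i shifted by multiples of pi/2 in <= 2 components *)
    (forall t : 'I_m -> int, (#|[set k in S | t k != 0]| <= 2)%N ->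
     forall j, j != i ->
       E_unif S (fun x => ell rho gs (P j) x ^+ 2) (shifted_angles R S a t) <= C * b ^- n) ->
    (* (i) *)
    (forall eps : R, 0 < eps <= 1 ->
       1 - K%:R * (1 + N%:R + m%:R + cmax) ^+ d * C * eps ^- 2 * b ^- n
       <= P_unif S [set x | approx_local_min eps (loss rho gs c P) x] (cliff_angles R a))
    /\
    (* (ii) *)
    (1 - K%:R * (1 + N%:R + m%:R) ^+ d * C * b ^- n
       <= P_cliff S [set x | approx_local_min 0 (loss rho gs c P) x] (cliff_angles R a)).
Proof.
(* The factor 9 counts the pairs of turns. The exponent is 6 from [d ^- 2] plus 3 from [N m^2]; in
   part (ii) the exponent 3 is enlarged to 9. *)
exists 9%N, 9%N => R n N m rho gs c P cmax i S a C b [V [cV ->]] cgs c_le C0 b1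
  L_min _ second_moment.
set rho0 := V *m _ *m _ in L_min second_moment *.
set beta := C * b ^- n in second_moment *.
have beta0 : 0 <= beta.
  by rewrite mulr_ge0 ?(ltW C0) // invr_ge0 exprn_ge0 // (le_trans _ (ltW b1)).
have cmax0 : 0 <= cmax by exact: le_trans (normr_ge0 _) (c_le i).
have N0 : (0 : R) <= N%:R by [].
have m0 : (0 : R) <= m%:R by [].
pose Z : 'rV[R]_m -> R := shifted_weight V gs P i.
have Zge0 y : 0 <= Z y by exact: shifted_weight_ge0.
have uF : uniq (enum (~: S)) by exact: enum_uniq.
have notF k : (k \notin enum (~: S)) = (k \in S) by rewrite mem_enum inE negbK.
have inF k : (k \in enum (~: S)) = (k \notin S) by rewrite mem_enum inE.
have Lmin (y : 'rV[R]_m) : (forall k, k \notin S -> 0 <= y 0 k < pi *+ 2) ->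
    (forall k, k \in S -> y 0 k = cliff_angles R a 0 k) ->
    c i * ell rho0 gs (P i) y = - `|c i|.
  move=> yF yS; rewrite -(L_min y yF); congr (_ * ell _ _ _ _).
  by apply/rowP => k; rewrite mxE; case: ifP => // /yS.
have powers (W : R) (r : nat) : 1 <= W -> (r <= 9)%N -> W ^+ r <= W ^+ 9.
  by move=> W1 r9; rewrite ler_weXn2l.
split=> [eps /andP[eps0 eps1]|].
- pose W := 1 + N%:R + m%:R + cmax.
  have W1 : 1 <= W by rewrite /W; lra.
  have W0 : 0 < W by exact: lt_le_trans W1.
  (* Since [m N cmax <= W ^+ 3], this gives [m N cmax d <= eps], which is at most [Num.sqrt eps]
     because [eps <= 1]. *)
  pose d := eps / W ^+ 3; pose w := (d ^+ 2)^-1.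
  have d0 : 0 < d by rewrite divr_gt0 ?exprn_gt0.
  have w0 : 0 < w by rewrite invr_gt0 exprn_gt0.
  have NcW : N%:R * cmax <= W ^+ 2.
    by rewrite expr2 ler_pM //; rewrite /W; lra.
  have NmcW : m%:R * (N%:R * cmax) <= W ^+ 3.
    by rewrite exprS ler_pM ?mulr_ge0 //; rewrite /W; lra.
  have Beps : N%:R * cmax * d <= eps.
    rewrite /d mulrA ler_pdivrMr ?exprn_gt0 // mulrC ler_pM2l //.
    by apply: le_trans NcW _; rewrite ler_weXn2l.
  have mBeps : m%:R * (N%:R * cmax * d) <= Num.sqrt eps.
    apply: (@le_trans _ _ eps).
      by rewrite mulrA /d mulrA ler_pdivrMr ?exprn_gt0 // mulrC ler_pM2l.
    rewrite -[leLHS]ger0_norm ?(ltW eps0) // -sqrtr_sqr ler_sqrt ?(ltW eps0) //.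
    by rewrite expr2 ler_piMl // ltW.
  apply: (@le_trans _ _ (E_cliff S (fun x => 1 - w * Z x) (cliff_angles R a))).
    apply: le_trans (E_affine_weight cgs beta0 second_moment (ltW w0)).
    rewrite lerD2l lerN2 /w /d expr_div_n invf_div -exprM.
    have NmW : N%:R * m%:R ^+ 2 <= W ^+ 3.
      rewrite (exprS W) ler_pM ?exprn_ge0 //; first by rewrite /W; lra.
      by rewrite ler_pXn2r ?nnegrE ?(ltW W0) //; rewrite /W; lra.
    rewrite (_ : W ^+ (3 * 2) / eps ^+ 2 * (9%:R * N%:R * m%:R ^+ 2 * beta) =
      (9%:R * eps ^- 2 * beta) * (W ^+ 6 * (N%:R * m%:R ^+ 2))); last by ring.
    rewrite (_ : 9%:R * W ^+ 9 * C * eps ^- 2 * b ^- n =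
      (9%:R * eps ^- 2 * beta) * (W ^+ 6 * W ^+ 3)); last by rewrite /beta; ring.
    have coef0 : 0 <= 9%:R * eps ^- 2 * beta.
      by rewrite (mulr_ge0 _ beta0) // mulr_ge0 // invr_ge0 exprn_ge0 // ltW.
    rewrite (ler_wpM2l coef0) //.
    by rewrite ler_wpM2l ?exprn_ge0 ?(ltW W0).
  apply: (@iter_cliff_avg_le _ _ (@unif_avg R) (fun t => 0 <= t < pi *+ 2)) => //.
  + by move=> f; exact: unif_avg_unit.
  + by move=> f g; exact: cliff_avg_le_unif_avg.
  + by move=> y; exact: indic_unit.
  + exact: affine_weight_trig2.
  move=> y yF yS.
  (* For small weight the indicator is 1 and the minorant at most 1; otherwise the minorant is
     negative. *)
  have [Zd|Zd] := leP (Z y) (d ^+ 2).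
    rewrite indicE mem_set /=; first by rewrite gerBl mulr_ge0 ?(ltW w0).
    apply: (approx_local_min_of_weight cV cgs c_le (ltW d0) _ Zd) => //.
    by apply: Lmin => k; [rewrite -inF; exact: yF|rewrite -notF; exact: yS].
  apply: (@le_trans _ _ 0); last first.
    by case/andP: (indic_unit R [set x | approx_local_min eps (loss rho0 gs c P) x] y).
  by rewrite subr_le0 /w mulrC ler_pdivlMr ?exprn_gt0 // mul1r ltW.
- pose W : R := 1 + N%:R + m%:R.
  have W1 : 1 <= W by rewrite /W; lra.
  have W0 : 0 < W by exact: lt_le_trans W1.
  (* The factor 1 suffices: at Clifford points [Z] is 0 or at least 1, so [1 - Z] stays below the
     indicator. *)
  apply: (@le_trans _ _ (E_cliff S (fun x => 1 - 1 * Z x) (cliff_angles R a))).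
    apply: le_trans (E_affine_weight cgs beta0 second_moment ler01).
    rewrite lerD2l lerN2 mul1r.
    rewrite (_ : 9%:R * N%:R * m%:R ^+ 2 * beta =
      (9%:R * beta) * (N%:R * m%:R ^+ 2)); last by ring.
    rewrite (_ : 9%:R * _ ^+ 9 * C * b ^- n = (9%:R * beta) * W ^+ 9); last first.
      by rewrite /beta /W; ring.
    have coef0 : 0 <= 9%:R * beta by rewrite mulr_ge0.
    rewrite (ler_wpM2l coef0) //; apply: le_trans (powers W 3 W1 isT).
    rewrite (exprS W) ler_pM ?exprn_ge0 //; first by rewrite /W; lra.
    by rewrite ler_pXn2r ?nnegrE ?(ltW W0) //; rewrite /W; lra.
  apply: (@iter_cliff_avg_le _ _ (@cliff_avg R)
    (fun t => [exists r : 'I_4, t == r%:R * pi / 2])) => //.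
  + by move=> f; exact: cliff_avg_unit.
  + move=> f g _ _ gf; apply: cliff_avg_le => r; apply: gf.
    by apply/existsP; exists r.
  + by move=> y; exact: indic_unit.
  + exact: affine_weight_trig2.
  move=> y yF yS; rewrite mul1r.
  have quarter k : exists r : 'I_4, y 0 k = r%:R * pi / 2.
    have [kS|kS] := boolP (k \in S).
      by exists (a k); rewrite yS ?notF // mxE.
    by have := yF k; rewrite inF kS => /(_ isT)/existsP[r /eqP ->]; exists r.
  have [r yr] := boolp.choice quarter.
  have yz k : y 0 k = ((r k)%:Z)%:~R * (pi / 2) by rewrite yr mulrA.
  have [Z0|Z1] := shifted_weight_clifford P i cV cgs yz; last first.
    apply: (@le_trans _ _ 0); first by rewrite subr_le0.
    by case/andP: (indic_unit R [set x | approx_local_min 0 (loss rho0 gs c P) x] y).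
  rewrite indicE mem_set /=; first by rewrite gerBl.
  (* With threshold [d = 0] the gradient and Hessian bounds become 0, as [eps = 0] demands. *)
  have Z00 : Z y <= 0 ^+ 2 by rewrite expr0n.
  apply: (approx_local_min_of_weight cV cgs c_le (lexx 0) _ Z00); rewrite ?mulr0 ?sqrtr0 //.
  apply: Lmin => k; last by rewrite -notF; exact: yS.
  (* The four angles lie in [[0, 2 pi)], where [L_min] applies. *)
  move=> _; rewrite yr; case: (r k) => [[|[|[|[|//]]]] lt4] /=;
    have := pi_gt0 R; rewrite -[pi *+ 2]mulr_natl; lra.
Qed.
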